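(* Let $p=6$, $\gamma>0$, $a>0$. Then $$\gamma^-(c)\to\frac{1}{3\sqrt{aK_{GN}}}\quad\text{as }c\to0^+ ,$$ and there exists a constant $K_1>0$ such that for every $c\in(0,c_1)$, if $\lambda_c^-\in\mathbb{R}$ denotes the Lagrange parameter associated to a solution $u_c^-$ lying at the level $\gamma^-(c)$ (that is, $u_c^-\in\Lambda^-(c)$, $F(u_c^-)=\gamma^-(c)$, and $u=u_c^-$ solves $-\Delta u+\lambda u-\gamma(|x|^{-1}*|u|^2)u-a|u|^{4}u=0$ in $\mathbb{R}^3$ with $\lambda=\lambda_c^-$), then $$\lambda_c^-\le K_1c^{1/2}.$$
   Context: $H^1(\mathbb{R}^3)$ is the usual Sobolev space of real-valued functions; solutions are weak solutions in $H^1(\mathbb{R}^3)$. Here $p=6$. For $u\in H^1(\mathbb{R}^3)$, $$A(u)=\int_{\mathbb{R}^3}|\nabla u|^2dx,\quad B(u)=\int_{\mathbb{R}^3}\int_{\mathbb{R}^3}\frac{|u(x)|^2|u(y)|^2}{|x-y|}dxdy,\quad C(u)=\int_{\mathbb{R}^3}|u|^6dx,$$ $F(u)=\frac12A(u)-\frac\gamma4B(u)-\frac a6C(u)$. $S(c)=\{u\in H^1(\mathbb{R}^3):\|u\|_{L^2}^2=c\}$. $K_H>0$ is a fixed constant, independent of $u$ and $c$, such that $B(u)\le K_H\sqrt{A(u)}\,c^{3/2}$ for all $c>0$, $u\in S(c)$, and $K_{GN}>0$ is the optimal (smallest) constant in the Sobolev inequality $C(u)\le K_{GN}[A(u)]^{3}$,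 $u\in H^1(\mathbb{R}^3)$. Moreover $$c_1=\left(\frac{16}{5\gamma K_H}\right)^{2/3}\left(\frac{1}{5aK_{GN}}\right)^{1/6}.$$ For $u\in S(c)$ and $t>0$ put $u^t(x)=t^{3/2}u(tx)$ and $g_u(t)=F(u^t)=\frac12t^2A(u)-\frac\gamma4tB(u)-\frac a6t^6 C(u)$. Define $\Lambda^-(c)=\{u\in S(c):g_u'(1)=0,\ g_u''(1)<0\}$ and $\gamma^-(c)=\inf_{u\in\Lambda^-(c)}F(u)$. *)

(* Defs.v *)
(* MathComp-Analysis. *)
From HB Require Import structures.
From mathcomp Require Import all_boot all_order all_algebra.
From mathcomp Require Import all_classical all_reals all_analysis.
Import Order.TTheory GRing.Theory Num.Theory.
Import numFieldNormedType.Exports.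

Set Implicit Arguments.
Unset Strict Implicit.
Unset Printing Implicit Defensive.

Local Open Scope classical_set_scope.
Local Open Scope ring_scope.

(* A point of R^3 is a triple ((x_0, x_1), x_2). The library puts
   [lebesgue_measure] on [measurableTypeR R], an alias of the carrier of R, so
   Lebesgue measure on R^3 lives on a product of these aliases, which is
   convertible to [R3 R]. *)
Definition R3 (R : realType) : Type := (R * R * R)%type.

Definition lebesgue_measure2 {R : realType} :
    set (measurableTypeR R * measurableTypeR R)%type -> \bar R :=
  (@lebesgue_measure R \x @lebesgue_measure R)%E.

HB.instance Definition _ (R : realType) := Measure.on (@lebesgue_measure2 R).

Definition lebesgue_measure3 {R : realType} :
    set (measurableTypeR R * measurableTypeR R * measurableTypeR R)%type ->
    \bar R :=
  (@lebesgue_measure2 R \x @lebesgue_measure R)%E.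

HB.instance Definition _ (R : realType) := Measure.on (@lebesgue_measure3 R).

Section SobolevSpace.
Variable R : realType.
Notation mu := (@lebesgue_measure3 R).
Implicit Types (u phi : R3 R -> R) (x y : R3 R).

(* Not `|x|, which is the sup norm on the product type. *)
Definition eucl_norm x : R := Num.sqrt (x.1.1 ^+ 2 + x.1.2 ^+ 2 + x.2 ^+ 2).

Definition eucl_dist x y : R :=
  eucl_norm (x.1.1 - y.1.1, x.1.2 - y.1.2, x.2 - y.2).

Definition basis_vect (i : 'I_3) : (R * R * R)%type :=
  ((i == 0 :> nat)%:R, (i == 1 :> nat)%:R, (i == 2 :> nat)%:R).

Definition partial (i : 'I_3) (phi : (R * R * R)%type -> R) : R3 R -> R :=
  fun x => 'D_(basis_vect i) phi x.

Definition partials (s : seq 'I_3) phi : R3 R -> R := foldr partial phi s.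

Definition smooth phi : Prop := forall s : seq 'I_3,
  continuous (partials s phi : (R * R * R)%type -> R) /\
  forall (i : 'I_3) x,
    derivable (partials s phi : (R * R * R)%type -> R) x (basis_vect i).

Definition compactly_supported phi : Prop :=
  compact (closure [set x : (R * R * R)%type | phi x != 0]).

Definition test_function phi : Prop := smooth phi /\ compactly_supported phi.

Definition weak_partial (i : 'I_3) u (g : R3 R -> R) : Prop :=
  g \in Lfun mu 2%:E /\
  forall phi, test_function phi ->
    \int[mu]_x (u x * partial i phi x) = - \int[mu]_x (g x * phi x).

(* Elements of H^1 are represented by functions, not by a.e.-classes. *)
Definition H1 : set (R3 R -> R) :=
  [set u | u \in Lfun mu 2%:E /\
           forall i, exists g : R3 R -> R, weak_partial i u g].

(* Weak derivatives are unique only almost everywhere; [grad u i] picks one. *)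
Definition grad u (i : 'I_3) : R3 R -> R :=
  xget (fun=> 0) [set g : R3 R -> R | weak_partial i u g].

End SobolevSpace.

Section SchroedingerPoissonSlater.
Variable R : realType.
Notation mu := (@lebesgue_measure3 R).
Implicit Types (u phi : R3 R -> R) (x y : R3 R) (c t : R).

(* [dirichlet], [hartree], [critical] and [energy] are A, B, C and F. *)
Definition dirichlet u : \bar R :=
  \int[mu]_x (\sum_(i < 3) `|grad u i x| ^+ 2)%:E.

(* On the diagonal x = y, which is negligible, the quotient is 0 here. *)
Definition hartree u : \bar R :=
  \int[mu]_x \int[mu]_y (`|u x| ^+ 2 * `|u y| ^+ 2 / eucl_dist x y)%:E.

Definition critical u : \bar R := \int[mu]_x (`|u x| ^+ 6)%:E.

Definition energy (gamma a : R) u : R :=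
  2^-1 * fine (dirichlet u) - gamma / 4 * fine (hartree u)
  - a / 6 * fine (critical u).

Definition mass_sphere c : set (R3 R -> R) :=
  [set u | H1 u /\ ('N[mu]_2%:E[EFin \o u] ^+ 2)%E = c%:E].

(* u^t(x) = t^{3/2} u(t x) *)
Definition dilation u t : R3 R -> R :=
  fun x => t `^ (3 / 2) * u (t * x.1.1, t * x.1.2, t * x.2).

Definition fibering (gamma a : R) u : R -> R :=
  fun t => energy gamma a (dilation u t).

Definition Lambda_minus (gamma a c : R) : set (R3 R -> R) :=
  [set u | [/\ mass_sphere c u, derive1 (fibering gamma a u) 1 = 0
             & derive1n 2 (fibering gamma a u) 1 < 0]].

(* The infimum of the empty set is +oo. *)
Definition gamma_minus (gamma a c : R) : \bar R :=
  ereal_inf [set (energy gamma a u)%:E | u in Lambda_minus gamma a c].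

Definition sobolev_constant (K : R) : Prop :=
  forall u, H1 u -> (critical u <= K%:E * dirichlet u ^+ 3)%E.

Definition optimal_sobolev_constant (K : R) : Prop :=
  sobolev_constant K /\ forall K', sobolev_constant K' -> K <= K'.

Definition hartree_constant (K : R) : Prop :=
  forall c u, 0 < c -> mass_sphere c u ->
    (hartree u <= (K * Num.sqrt (fine (dirichlet u)) * c `^ (3 / 2))%:E)%E.

(* (|.|^{-1} * |u|^2)(x) *)
Definition newton_potential u x : R :=
  \int[mu]_y (`|u y| ^+ 2 / eucl_dist x y).

(* - Delta u + lambda u - gamma (|x|^{-1} * |u|^2) u - a |u|^4 u = 0 in the dual
   of H^1. *)
Definition weak_solution (gamma a lambda : R) u : Prop :=
  H1 u /\ forall phi, H1 phi ->
    \int[mu]_x (\sum_(i < 3) grad u i x * grad phi i x)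
    + lambda * \int[mu]_x (u x * phi x)
    - gamma * \int[mu]_x (newton_potential u x * u x * phi x)
    - a * \int[mu]_x (`|u x| ^+ 4 * u x * phi x) = 0.

Definition c_one (gamma a KH KGN : R) : R :=
  (16 / (5 * gamma * KH)) `^ (2 / 3) * (1 / (5 * a * KGN)) `^ (1 / 6).

End SchroedingerPoissonSlater.

(* Main.v *)
(* For u in Lambda^-(c), g_u'(1) = 0 and g_u''(1) < 0 give
   a C(u) = A(u) - (gamma/4) B(u) and A(u) < 5 a C(u) <= 5 a K_GN A(u)^3. As
   B(u) = O(sqrt A(u) c^(3/2)), A(u) is at least (a K_GN)^(-1/2) up to
   O(c^(3/2)), hence so is F(u) = A(u)/3 - (5 gamma/24) B(u) with respect to
   the limit level. Conversely, for c < c_1 the fibering map of a rescaled near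
   optimizer of the Sobolev inequality has a critical point with g'' < 0, whose
   level is at most max_y (y/2 - a K' y^3/6) = 1/(3 sqrt (a K')). Testing the
   equation with u itself gives lambda c = (3/4) gamma B(u), and A(u) is bounded
   at the level gamma^-(c).
   The formulas for A(u^t), B(u^t), C(u^t) come from the change of variables
   x |-> t x; for A one also needs the a.e. uniqueness of weak derivatives, which
   is proved with tensor products of the flat functions exp(-k/x). *)

From HB Require Import structures.
Require Import Defs.
From mathcomp Require Import all_boot all_order all_algebra.
From mathcomp Require Import all_classical all_reals all_analysis.
From mathcomp Require Import measurable_realfun.
From mathcomp Require Import ring lra.
Import Order.TTheory GRing.Theory Num.Theory.
Import numFieldNormedType.Exports.

Set Implicit Arguments.
Unset Strict Implicit.
Unset Printing Implicit Defensive.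

Local Open Scope classical_set_scope.
Local Open Scope ring_scope.

(** * Scaling of Lebesgue measure *)

(** Extremals of the Sobolev inequality decay like [1/|x|] and are not square integrable on R^3, so
    the upper bound cannot start from an optimizer: for each [K' < KGN] it starts from a function
    violating the inequality with [K']. The quotient C/A^3 is invariant under multiplication by
    constants, which adjusts the mass, and under dilations, which move the function onto Lambda^-;
    the violation survives both. The constant c_1 is the mass up to which the bound on B makes g_u'
    positive at the inflection point of g_u. Beyond that point g_u is concave, so the zero of g_u'
    found there has g_u'' < 0. Two conventions shape the formal part. [fine] sends infinite values
    to 0, so real identities rest on finiteness or on scaling laws valid for all extended reals. And
    [grad] picks some weak derivative: the choices made for u and for u^t are unrelated, and only
    their almost everywhere uniqueness relates A(u^t) to A(u). *)

(* The canonical instance of the library for [m1 \x m2] is masked by the one for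
   products of subprobabilities. *)
Lemma sigma_finite_prod d1 d2 (T1 : measurableType d1) (T2 : measurableType d2)
    (R : realType) (m1 : {sigma_finite_measure set T1 -> \bar R})
    (m2 : {sigma_finite_measure set T2 -> \bar R}) :
  sigma_finite setT (m1 \x m2)%E.
Proof.
have /sigma_finiteP[F [FT ndF Ffin]] := sigma_finiteT m1.
have /sigma_finiteP[G [GT ndG Gfin]] := sigma_finiteT m2.
exists (fun n => F n `*` G n).
  apply/seteqP; split => // -[x y] _.
  have [n _ Fx] : (\bigcup_i F i) x by rewrite -FT.
  have [k _ Gy] : (\bigcup_i G i) y by rewrite -GT.
  exists (maxn n k) => //; split => /=.
    by apply: (subsetPset _ _ (ndF n _ _)) Fx; exact: leq_maxl.
  by apply: (subsetPset _ _ (ndG k _ _)) Gy; exact: leq_maxr.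
move=> n; have [mF Fy] := Ffin n; have [mG Gy] := Gfin n.
split; first exact: measurableX.
by rewrite product_measure1E// lte_mul_pinfty// ge0_fin_numE.
Qed.

(** A positive finite factor fixes both infinities, so even the conventional value of [+oo - +oo] is
    respected. This lets integrals be rescaled without an integrability assumption. *)
Lemma pmuleBr (R : realType) (k : R) (x y : \bar R) : 0 < k ->
  (k%:E * (x - y) = k%:E * x - k%:E * y)%E.
Proof.
move=> k0; case: x => [x| |]; case: y => [y| |];
  rewrite /= ?gt0_muley ?gt0_muleNy ?lte_fin//=.
by rewrite -EFinB -!EFinM mulrBr.
Qed.

Lemma fine_pmule (R : realType) (k : R) (x : \bar R) : 0 < k ->
  fine (k%:E * x)%E = k * fine x.
Proof.
move=> k0; case: x => [x//| |]; last by rewrite gt0_muleNy ?lte_fin//= mulr0.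
by rewrite gt0_muley ?lte_fin//= mulr0.
Qed.

Section Scaling.
Variable R : realType.
Notation l1 := (@lebesgue_measure R).
Notation mu := (@lebesgue_measure3 R).

HB.instance Definition _ := Measure_isSigmaFinite.Build _ _ _
  (@lebesgue_measure2 R) (sigma_finite_prod l1 l1).

HB.instance Definition _ := Measure_isSigmaFinite.Build _ _ _
  mu (sigma_finite_prod (@lebesgue_measure2 R) l1).

Lemma measurable_mulr r :
  measurable_fun setT (fun x : measurableTypeR R => r * x : measurableTypeR R).
Proof. by apply: measurable_funM. Qed.

(** The pushforward of Lebesgue measure by [x |-> r x], multiplied by [r], gives []a, b]] its
    length, and Lebesgue measure is determined by these intervals. *)
Lemma lebesgue_measure_scale (r : R) (A : set (measurableTypeR R)) :
  0 < r -> measurable A -> (l1 ((fun x => (r * x)%R) @^-1` A) = r^-1%:E * l1 A)%E.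
Proof.
move=> r0 mA.
have mf : measurable_fun setT (fun x : measurableTypeR R => r * x : measurableTypeR R).
  exact: measurable_mulr.
pose phi := fun x : measurableTypeR R => r * x : measurableTypeR R.
pose k := NngNum (ltW r0).
pose m' : {measure set (measurableTypeR R) -> \bar R} := mscale k (pushforward l1 phi).
suff : (l1 A = m' mf A)%E.
  move=> ->; rewrite /= /mscale /pushforward /= muleA -EFinM mulVf ?gt_eqF// mul1e//.
apply: lebesgue_measure_unique => //.
move=> X [[a b] /= _ <-].
rewrite /mscale/= /pushforward/=.
rewrite [X in (_ = _ * l1 X)%E](_ : _ = `](r^-1 * a), (r^-1 * b)]%classic); last first.
  apply/seteqP; split => x /=; rewrite !in_itv/=.
    by rewrite ltr_pdivrMl// ler_pdivlMl//.
  by rewrite ltr_pdivrMl// ler_pdivlMl.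
rewrite !lebesgue_measure_itv/= !lte_fin ltr_pM2l ?invr_gt0//.
case: ifPn => ab; rewrite ?mule0// -!EFinD -EFinM -mulrBr mulrA mulfV ?gt_eqF// mul1r//.
Qed.

Definition scale3 (r : R) (x : R3 R) : R3 R := (r * x.1.1, r * x.1.2, r * x.2).

Lemma measurable_scale2 r : measurable_fun setT
  (fun x : measurableTypeR R * measurableTypeR R =>
     (r * x.1, r * x.2) : (measurableTypeR R * measurableTypeR R)%type).
Proof.
apply/measurable_fun_pairP; split => /=.
  exact: (measurableT_comp (measurable_mulr r) measurable_fst).
exact: (measurableT_comp (measurable_mulr r) measurable_snd).
Qed.

Lemma measurable_scale3 r : measurable_fun setT (scale3 r :
  (measurableTypeR R * measurableTypeR R * measurableTypeR R)%type ->
   (measurableTypeR R * measurableTypeR R * measurableTypeR R)%type).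
Proof.
apply/measurable_fun_pairP; split => /=.
  exact: (measurableT_comp (measurable_scale2 r) measurable_fst).
exact: (measurableT_comp (measurable_mulr r) measurable_snd).
Qed.

(** The pushforward divided by [k1 * k2] has the right value on rectangles; uniqueness of the
    product measure does the rest. Used twice to climb from R to R^3. *)
Lemma product_measure_preimage d1 d2 (T1 : measurableType d1)
    (T2 : measurableType d2) (m1 : {sigma_finite_measure set T1 -> \bar R})
    (m2 : {sigma_finite_measure set T2 -> \bar R})
    (f1 : T1 -> T1) (f2 : T2 -> T2) (k1 k2 : R) :
  measurable_fun setT f1 -> measurable_fun setT f2 -> 0 < k1 -> 0 < k2 ->
  (forall A, measurable A -> m1 (f1 @^-1` A) = (k1%:E * m1 A)%E) ->
  (forall A, measurable A -> m2 (f2 @^-1` A) = (k2%:E * m2 A)%E) ->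
  forall A, measurable A ->
  ((m1 \x m2) ((fun x => (f1 x.1, f2 x.2)) @^-1` A) =
   (k1 * k2)%:E * (m1 \x m2) A)%E.
Proof.
move=> mf1 mf2 k10 k20 m1f m2f A mA.
pose f x := (f1 x.1, f2 x.2).
have mf : measurable_fun setT f.
  apply/measurable_fun_pairP; split => /=.
    exact: (measurableT_comp mf1 measurable_fst).
  exact: (measurableT_comp mf2 measurable_snd).
have k0 : 0 <= (k1 * k2)^-1 by rewrite invr_ge0 ltW// mulr_gt0.
pose m' : {measure set (T1 * T2)%type -> \bar R} :=
  mscale (NngNum k0) (pushforward (m1 \x m2)%E f).
suff h : forall B C, measurable B -> measurable C ->
    m' mf (B `*` C) = (m1 B * m2 C)%E.
  rewrite [in RHS](product_measure_unique h)// /= /mscale/= muleA -EFinM.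
  by rewrite mulfV ?gt_eqF ?mulr_gt0// mul1e.
move=> B C mB mC.
rewrite /= /mscale/= /pushforward/=.
rewrite [X in product_measure1 _ _ X](_ : _ = (f1 @^-1` B) `*` (f2 @^-1` C))//.
have mfB : measurable (f1 @^-1` B) by rewrite -[X in measurable X]setTI; exact: mf1.
have mfC : measurable (f2 @^-1` C) by rewrite -[X in measurable X]setTI; exact: mf2.
rewrite product_measure1E//.
rewrite [X in (_ * (X * _))%E](m1f _ mB) [X in (_ * (_ * X))%E](m2f _ mC).
suff e (p q : \bar R) :
  (((k1 * k2)^-1)%:E * ((k1%:E * p) * (k2%:E * q)) = p * q)%E by exact: e.
have -> : (k1%:E * p * (k2%:E * q) = (k1 * k2)%:E * (p * q))%E by rewrite EFinM muleACA.
rewrite muleA -EFinM.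
by rewrite mulVf ?mul1e// gt_eqF// mulr_gt0.
Qed.

Lemma lebesgue_measure3_scale (r : R) A : 0 < r -> measurable A ->
  mu (scale3 r @^-1` A) = ((r ^- 3)%:E * mu A)%E.
Proof.
move=> r0 mA.
have r1 : 0 < r^-1 by rewrite invr_gt0.
have h2 B : measurable B -> @lebesgue_measure2 R
    ((fun x => (r * x.1, r * x.2)) @^-1` B) =
    ((r^-1 * r^-1)%:E * @lebesgue_measure2 R B)%E.
  move=> mB; apply: (product_measure_preimage (measurable_mulr r)
    (measurable_mulr r)) => // C mC; exact: lebesgue_measure_scale.
have -> : r ^- 3 = r^-1 * r^-1 * r^-1 by rewrite -exprVn exprSr expr2.
apply: (product_measure_preimage (measurable_scale2 r) (measurable_mulr r) _ r1
  h2 (fun A => @lebesgue_measure_scale r A r0) mA).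
exact: mulr_gt0.
Qed.

Notation T3 := (measurableTypeR R * measurableTypeR R * measurableTypeR R)%type.

Lemma ge0_integral_scale3 (r : R) (f : R3 R -> \bar R) : 0 < r ->
  measurable_fun setT (f : T3 -> \bar R) -> (forall x, 0 <= f x)%E ->
  (\int[mu]_x f (scale3 r x) = (r ^- 3)%:E * \int[mu]_x f x)%E.
Proof.
move=> r0 mf f0.
have k0 : 0 <= r ^- 3 by rewrite invr_ge0 exprn_ge0// ltW.
have -> : (r ^- 3)%:E = ((NngNum k0)%:num)%:E by [].
rewrite -ge0_integral_mscale//.
rewrite -[LHS](ge0_integral_pushforward (measurable_scale3 r) mu measurableT mf)//.
have mphi := measurable_scale3 r.
apply: (@eq_measure_integral _ _ _ _ _).
move=> A mA _ ; rewrite /= /pushforward /mscale/=.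
exact: lebesgue_measure3_scale.
Qed.

Lemma integral_scale3 (r : R) (f : R3 R -> \bar R) : 0 < r ->
  measurable_fun setT (f : T3 -> \bar R) ->
  (\int[mu]_x f (scale3 r x) = (r ^- 3)%:E * \int[mu]_x f x)%E.
Proof.
move=> r0 mf.
have k0 : 0 < r ^- 3 by rewrite invr_gt0 exprn_gt0.
transitivity (\int[mu]_x (f^\+ (scale3 r x)) - \int[mu]_x (f^\- (scale3 r x)))%E.
  have := integralE mu setT (f \o scale3 r).
  by rewrite funepos_comp funeneg_comp.
rewrite (ge0_integral_scale3 r0 (measurable_funepos mf) (funepos_ge0 f)).
rewrite (ge0_integral_scale3 r0 (measurable_funeneg mf) (funeneg_ge0 f)).
by rewrite -pmuleBr// -integralE.
Qed.

Lemma Rintegral_scale3 (r : R) (f : R3 R -> R) : 0 < r ->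
  measurable_fun setT (f : T3 -> R) ->
  \int[mu]_x f (scale3 r x) = r ^- 3 * \int[mu]_x f x.
Proof.
move=> r0 mf; rewrite /Rintegral.
rewrite (integral_scale3 (f := EFin \o f) r0); last exact/measurable_EFinP.
by rewrite fine_pmule// invr_gt0 exprn_gt0.
Qed.

End Scaling.

(** * Continuity and smoothness under dilations *)

Section Smooth.
Variable R : realType.
Notation T3 := (measurableTypeR R * measurableTypeR R * measurableTypeR R)%type.

(** Links the topology of the triple product to its product sigma-algebra: [V] is the countable
    union of the boxes with rational endpoints that it contains. *)
Lemma open_measurable3 (V : set (R * R * R)%type) : open V ->
  measurable (V : set T3).
Proof.
move=> oV.
pose box (q : (rat * rat) * (rat * rat) * (rat * rat)) : set T3 :=
  (`]ratr q.1.1.1, ratr q.1.1.2[ `*` `]ratr q.1.2.1, ratr q.1.2.2[) `*`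
  `]ratr q.2.1, ratr q.2.2[.
pose F q : set T3 := if pselect (box q `<=` V) then box q else set0.
have -> : V = \bigcup_q F q.
  apply/seteqP; split => [x Vx|x [q _]]; last first.
    by rewrite /F; case: pselect => // h; exact: h.
  move: oV; rewrite openE => /(_ _ Vx) /nbhs_ballP[e /= e0 eV].
  have near_itv (y z a b : R) :
      y - e < a -> b < y + e -> a < z -> z < b -> ball y e z.
    by move=> ? ? ? ?; rewrite /ball/= ltr_distlC; apply/andP; split; lra.
  have lo (y : R) : exists q : rat, y - e < ratr q < y.
    have [|q] := @rat_in_itvoo R (y - e) y; first by rewrite ltrBlDr ltrDl.
    by rewrite in_itv/= => ?; exists q.
  have hi (y : R) : exists q : rat, y < ratr q < y + e.
    have [|q] := @rat_in_itvoo R y (y + e); first by rewrite ltrDl.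
    by rewrite in_itv/= => ?; exists q.
  have [a1 /andP[a1l a1r]] := lo x.1.1; have [b1 /andP[b1l b1r]] := hi x.1.1.
  have [a2 /andP[a2l a2r]] := lo x.1.2; have [b2 /andP[b2l b2r]] := hi x.1.2.
  have [a3 /andP[a3l a3r]] := lo x.2; have [b3 /andP[b3l b3r]] := hi x.2.
  exists ((a1, b1), (a2, b2), (a3, b3)) => //; rewrite /F; case: pselect => [subV|nV].
    by split; [split|]; rewrite /= in_itv/=; apply/andP.
  exfalso; apply: nV => z [[/=]]; rewrite !in_itv/=.
  move=> /andP[z1l z1r] /andP[z2l z2r] /andP[z3l z3r].
  by apply: eV; split; [split|]; apply: near_itv; eassumption.
apply: countable_bigcupT_measurable => //.
move=> q; rewrite /F; case: pselect => [subV|nV]; last exact: measurable0.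
by apply: measurableX => //; exact: measurableX.
Qed.

Lemma continuous_measurable3 (f : R * R * R -> R) : continuous f ->
  measurable_fun setT (f : T3 -> R).
Proof.
move=> /continuousP cf; apply: (measurability _ (RGenOpens.measurableE R)).
move=> _ [_ [a [b ->] <-]]; rewrite setTI; apply: open_measurable3.
exact/cf/interval_open.
Qed.

Notation E3 := (R * R * R)%type.

Lemma continuous_scale3 r : continuous (@scale3 R r : E3 -> E3).
Proof.
move=> x; rewrite /continuous_at (_ : scale3 r = *:%R r :> (E3 -> E3)) //.
exact: cvgZr.
Qed.

(** Only the derivative along [v] is assumed to exist, not differentiability. The difference
    quotient of the composite at [h] is [r] times that of [f] at [r * h], and [r * h] tends to 0
    while avoiding 0. *)
Lemma is_derive_scale3 (r d : R) (f : E3 -> R) (x v : E3) : 0 < r ->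
  is_derive (scale3 r x : E3) v f d -> is_derive x v (f \o @scale3 R r) (r * d).
Proof.
move=> r0 [df dE].
have cr : (fun h => r * h) @ 0^' --> (0 : R)^'.
  move=> A [e /= e0 Ae]; exists (r^-1 * e) => /=; first by rewrite mulr_gt0// invr_gt0.
  move=> h; rewrite /= sub0r normrN => he h0; apply: Ae => /=; last first.
    by rewrite mulf_neq0// gt_eqF.
  by rewrite sub0r normrN normrM gtr0_norm// -ltr_pdivlMl.
have h : h^-1 *: ((f \o @scale3 R r) (h *: v + x) - (f \o @scale3 R r) x) @[h --> 0^'] --> r * d.
  have -> : (fun h => h^-1 *: ((f \o @scale3 R r) (h *: v + x) - (f \o @scale3 R r) x)) =
     (fun h => r * ((r * h)^-1 *: (f ((r * h) *: v + scale3 r x) - f (scale3 r x)))).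
    apply/funext => h /=.
    have -> : scale3 r (h *: v + x) = (r * h) *: v + scale3 r x.
      by rewrite /scale3; congr (_, _, _) => /=; rewrite mulrDr mulrA.
    by rewrite -[(_ * _)^-1 *: _]/((_ * _)^-1 * _) invfM !mulrA mulfV ?gt_eqF// mul1r.
  apply: cvgM; first exact: cvg_cst.
  rewrite -dE.
  apply: (@cvg_comp _ _ _ (fun h => r * h)
    (fun h => h^-1 *: (f (h *: v + scale3 r x) - f (scale3 r x))) _ _ _ cr).
  exact: df.
split; first by apply/cvg_ex; exists (r * d).
exact: cvg_lim.
Qed.

Lemma partials_scale3 (r : R) (phi : R3 R -> R) (s : seq 'I_3) : 0 < r ->
  smooth phi ->
  partials s (phi \o scale3 r) =
    (fun x => r ^+ size s * partials s phi (scale3 r x)).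
Proof.
move=> r0 sphi; elim: s => [|i s IH] /=.
  by apply/funext => x; rewrite expr0 mul1r.
rewrite IH; apply/funext => x; rewrite /partial.
have [_ dp] := sphi s.
have := is_derive_scale3 r0 (derivableP (dp i (scale3 r x))).
move=> /(is_deriveZ (r ^+ size s)) [_ e].
by rewrite exprSr -mulrA; exact: e.
Qed.

Lemma smooth_scale3 (r : R) (phi : R3 R -> R) : 0 < r -> smooth phi ->
  smooth (phi \o scale3 r).
Proof.
move=> r0 sphi s; rewrite partials_scale3//; have [cp dp] := sphi s; split.
  move=> x; apply: cvgM; first exact: cvg_cst.
  apply: (@cvg_comp _ _ _ (scale3 r : E3 -> E3) (partials s phi)).
    exact: continuous_scale3.
  exact: cp.
move=> i x.
have := is_derive_scale3 r0 (derivableP (dp i (scale3 r x))).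
by move=> /(is_deriveZ (r ^+ size s)) [].
Qed.

Lemma scale3K (r : R) : 0 < r -> cancel (@scale3 R r) (scale3 r^-1).
Proof.
move=> r0 [[x y] z]; rewrite /scale3/=.
by congr (_, _, _); rewrite mulrA mulVf ?gt_eqF// mul1r.
Qed.

Lemma test_function_scale3 (r : R) (phi : R3 R -> R) : 0 < r ->
  test_function phi -> test_function (phi \o scale3 r).
Proof.
move=> r0 [sphi cphi]; split; first exact: smooth_scale3.
rewrite /compactly_supported in cphi *.
set K := closure _ in cphi.
have cK : compact ((scale3 r^-1 : E3 -> E3) @` K).
  apply: continuous_compact => //.
  by apply: continuous_subspaceT => x; exact: continuous_scale3.
apply: (subclosed_compact (@closed_closure _ _) cK).
have clK : closed ((scale3 r^-1 : E3 -> E3) @` K).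
  by apply: compact_closed.
rewrite [X in _ `<=` X]((closure_id _).1 clK); apply: closureS => x /= h.
exists (scale3 r x); last exact: scale3K.
exact: subset_closure.
Qed.

End Smooth.

(** * Smooth functions of one variable and their tensor products *)

Section CkFunctions.
Variable R : realType.
Implicit Types (f g : R -> R) (n : nat).

Fixpoint Ck n f : Prop :=
  if n is m.+1 then
    exists g, (forall x, is_derive x (1 : R) f (g x)) /\ Ck m g
  else continuous f.

Lemma is_derive_continuous f g : (forall x, is_derive x (1 : R) f (g x)) ->
  continuous f.
Proof.
move=> df x; apply: differentiable_continuous; apply/derivable1_diffP.
exact: ex_derive.
Qed.

Lemma CkS n f : Ck n.+1 f -> Ck n f.
Proof.
elim: n f => [|n IH] f [g [df Cg]]; first exact: is_derive_continuous df.
by exists g; split => //; exact: IH.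
Qed.

Lemma Ck_cst n (c : R) : Ck n (fun=> c).
Proof.
elim: n c => [|n IH] c; first by move=> x; exact: cvg_cst.
by exists (fun=> 0); split => // x; exact: is_derive_cst.
Qed.

Lemma CkD n f g : Ck n f -> Ck n g -> Ck n (fun x => f x + g x).
Proof.
elim: n f g => [|n IH] f g; first by move=> cf cg x; apply: cvgD; [exact: cf|exact: cg].
move=> [f' [df Cf]] [g' [dg Cg]]; exists (fun x => f' x + g' x).
by split; [move=> x; exact: is_deriveD|exact: IH].
Qed.

Lemma CkM n f g : Ck n f -> Ck n g -> Ck n (fun x => f x * g x).
Proof.
elim: n f g => [|n IH] f g; first by move=> cf cg x; apply: cvgM; [exact: cf|exact: cg].
move=> fC gC; have [f' [df Cf]] := fC; have [g' [dg Cg]] := gC.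
exists (fun x => f x * g' x + g x * f' x); split.
  by move=> x; exact: is_deriveM.
by apply: CkD; apply: IH => //; exact: CkS.
Qed.

Lemma Ck_affine n f (a b : R) : Ck n f -> Ck n (fun x => f (a * x + b)).
Proof.
have da x : is_derive x (1 : R) (fun x => a * x + b) a.
  have h1 : is_derive x (1 : R) (fun x => a * x) (a * 1).
    exact: (is_deriveZ a (is_derive_id x 1)).
  by have := is_deriveD h1 (is_derive_cst b x 1); rewrite mulr1 addr0.
elim: n f => [|n IH] f; first last.
  move=> [g [df Cg]]; exists (fun x => g (a * x + b) * a); split.
    by move=> x; exact: (is_derive1_comp (df _) (da x)).
  by apply: CkM; [exact: IH|exact: Ck_cst].
move=> cf x; apply: (@cvg_comp _ _ _ (fun x => a * x + b) f); last exact: cf.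
exact: (is_derive_continuous da).
Qed.

Definition smooth1 f := forall n, Ck n f.

(** The definition provides one derivative for each order [n]; all of them equal ['D_1 f], which is
    therefore smooth itself. *)
Lemma smooth1_derive f : smooth1 f ->
  exists2 g, (forall x, is_derive x (1 : R) f (g x)) & smooth1 g.
Proof.
move=> sf; exists ('D_1 f) => [x|n].
  by have [g [df _]] := sf 1%N; apply: derivableP; have [] := df x.
have [g [df Cg]] := sf n.+1.
by rewrite (_ : 'D_1 f = g)//; apply/funext => x; have [_] := df x.
Qed.

Lemma smooth1_continuous f : smooth1 f -> continuous f.
Proof. by move=> /(_ 0). Qed.

(* The functions P(1/x) exp(-k/x) on x > 0, extended by 0: this class is stable
   under differentiation, P becoming X^2 (k P - P'). *)
Definition flat (k : R) (P : {poly R}) (x : R) : R :=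
  if 0 < x then P.[x^-1] * expR (- (k * x^-1)) else 0.

Lemma exprn_le_expR n (y : R) : 0 <= y -> y ^+ n <= n`!%:R * expR y.
Proof.
move=> y0; rewrite -ler_pdivrMl ?ltr0n ?fact_gt0// mulrC.
case: n => [|n]; first by rewrite expr0 invr1 mulr1 -expR0 ler_expR.
by apply: le_trans (expR_ge1Dxn n y0); rewrite lerDr.
Qed.

Lemma poly_expR_bound (k : R) (P : {poly R}) : 0 < k ->
  exists2 M : R, 0 <= M & forall y, 0 <= y -> `|P.[y] * expR (- (k * y))| <= M.
Proof.
move=> k0.
(* For each monomial, [(k y)^i <= i! exp(k y)] gives [y^i exp(-k y) <= i!/k^i]. *)
exists (\sum_(i < size P) `|P`_i| * (i`!%:R / k ^+ i)).
  by apply: sumr_ge0 => i _; rewrite mulr_ge0// divr_ge0// exprn_ge0// ltW.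
move=> y y0; rewrite horner_coef mulr_suml.
apply: le_trans (ler_norm_sum _ _ _) _; apply: ler_sum => i _.
rewrite -mulrA normrM ler_wpM2l//.
rewrite ger0_norm; last by rewrite mulr_ge0// ?exprn_ge0// expR_ge0.
rewrite expRN ler_pdivrMr ?expR_gt0// mulrAC ler_pdivlMr ?exprn_gt0//.
by rewrite -exprMn [y * k]mulrC exprn_le_expR// mulr_ge0// ltW.
Qed.

Lemma is_derive_flat (k : R) (P : {poly R}) x : 0 < k ->
  is_derive x (1 : R) (flat k P) (flat k ('X^2 * (k *: P - P^`())) x).
Proof.
move=> k0; have [x0|x0|->] := ltrgt0P x.
- rewrite {2}/flat x0.
  apply: (@near_eq_is_derive R R R (fun z => P.[z^-1] * expR (- (k * z^-1))) (flat k P) x 1).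
    near=> z; rewrite /flat ifT//; near: z.
    exact: lt_nbhsr.
  have dV : is_derive x (1 : R) (fun z : R => z^-1) (- x ^- 2).
    apply: is_derive_eq; first by apply: is_deriveV; rewrite gt_eqF.
    by rewrite -[LHS]/(_ * _) mulr1.
  have dP : is_derive x (1 : R) (fun z : R => P.[z^-1]) (P^`().[x^-1] * - x ^- 2).
    by apply: (is_derive1_comp _ dV).
  have dE : is_derive x (1 : R) (fun z : R => expR (- (k * z^-1)))
     (expR (- (k * x^-1)) * (k * x ^- 2)).
    have h : is_derive x (1 : R) (fun z : R => - (k * z^-1)) (k * x ^- 2).
      have := is_deriveN (is_deriveZ k dV).
      by rewrite -[k *: - _]/(k * - _) mulrN opprK.
    exact: (is_derive1_comp (is_derive_expR _) h).
  apply: (is_derive_eq (is_deriveM dP dE)).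
  rewrite -![_ *: _]/(_ * _) hornerM hornerD hornerN hornerZ hornerXn exprVn.
  ring.
- rewrite {2}/flat ltNge (ltW x0)/=.
  apply: (@near_eq_is_derive R R R (cst 0) (flat k P) x 1).
  near=> z; rewrite /flat ifF//; apply/negbTE; rewrite -leNgt ltW//; near: z.
  exact: lt_nbhsl.
rewrite {2}/flat ltxx.
(* At the origin the bound is applied to [X^2 P] rather than [P]: the two extra powers of [1/h] give
   [|flat k P h| <= M h^2], so the difference quotient tends to 0. *)
have [M M0 PM] := poly_expR_bound ('X^2 * P) k0.
have bnd h : `|flat k P h| <= M * `|h| ^+ 2.
  rewrite /flat; case: ifPn => h0; last by rewrite normr0 mulr_ge0// exprn_ge0.
  have := PM h^-1; rewrite invr_ge0 ltW// => /(_ isT).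
  rewrite hornerM hornerXn -mulrA normrM exprVn normfV normrX.
  by rewrite ler_pdivrMl ?exprn_gt0 ?normr_gt0 ?gt_eqF// [M * _]mulrC.
have cv : h^-1 *: ((flat k P \o shift 0) (h *: 1) - flat k P 0) @[h --> 0^'] --> (0 : R).
  apply/cvgrPdist_le => e e0; near=> h.
  rewrite sub0r normrN /= addr0 {2}/flat ltxx subr0 -[_ *: _]/(_ * _).
  rewrite -[h *: 1]/(h * 1) mulr1 normrM normfV.
  have h0 : 0 < `|h| by rewrite normr_gt0; near: h; exact: nbhs_dnbhs_neq.
  rewrite ler_pdivrMl//; apply: (le_trans (bnd h)).
  rewrite expr2 mulrA mulrC ler_wpM2l ?normr_ge0//.
  have hM : `|h| <= e / (M + 1).
    near: h; apply: dnbhs0_le; by rewrite divr_gt0// ltr_wpDl.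
  apply: (@le_trans _ _ ((M + 1) * `|h|)); first by rewrite ler_wpM2r// lerDl.
  by rewrite -ler_pdivlMl ?ltr_wpDl// mulrC.
split; first by apply/cvg_ex; exists 0.
exact: cvg_lim.
Unshelve. all: by end_near. Qed.

Lemma smooth1_flat (k : R) (P : {poly R}) : 0 < k -> smooth1 (flat k P).
Proof.
move=> k0 n; elim: n P => [|n IH] P.
  by apply: is_derive_continuous => x; exact: is_derive_flat.
exists (flat k ('X^2 * (k *: P - P^`()))); split => [x|]; last exact: IH.
exact: is_derive_flat.
Qed.

End CkFunctions.

Section Tensor.
Variable R : realType.
Implicit Types (f g h : R -> R).
Notation T3 := (measurableTypeR R * measurableTypeR R * measurableTypeR R)%type.
Notation E3 := (R * R * R)%type.
Notation mu := (@lebesgue_measure3 R).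

Definition tensor f g h : E3 -> R := fun x => f x.1.1 * g x.1.2 * h x.2.

(** Here [p] is a coordinate and [v] a basis vector: along [v] the coordinate is either constant or
    moves at unit speed, and the difference quotient is 0 or that of [f]. *)
Lemma is_derive_coord (p : E3 -> R) f (d : R) (x v : E3) :
  (forall (k : R) (y : E3), p (k *: v + y) = k * p v + p y) ->
  p v = 0 \/ p v = 1 -> is_derive (p x) (1 : R) f d ->
  is_derive x v (f \o p) (p v * d).
Proof.
move=> plin pv [df dE].
have cv : k^-1 *: (((f \o p) \o shift x) (k *: v) - (f \o p) x) @[k --> 0^']
    --> p v * d.
  have [pv0|pv1] := pv.
    rewrite pv0 mul0r; apply: cvg_near_cst; near=> k.
    by rewrite /= plin pv0 mulr0 add0r subrr scaler0.
  rewrite pv1 mul1r -dE (_ : (fun k => _) =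
      (fun k => k^-1 *: ((f \o shift (p x)) (k *: (1 : R)) - f (p x)))); first exact: df.
  by apply/funext => k; rewrite /= plin pv1.
split; first by apply/cvg_ex; exists (p v * d).
exact: cvg_lim.
Unshelve. all: by end_near. Qed.

Lemma tensor_continuous f g h : continuous f -> continuous g -> continuous h ->
  continuous (tensor f g h).
Proof.
move=> cf cg ch x; apply: cvgM; last first.
  by apply: (@cvg_comp _ _ _ snd h); [exact: cvg_snd|exact: ch].
apply: cvgM.
  apply: (@cvg_comp _ _ _ fst (f \o fst)); first exact: cvg_fst.
  by apply: (@cvg_comp _ _ _ fst f); [exact: cvg_fst|exact: cf].
apply: (@cvg_comp _ _ _ fst (g \o snd)); first exact: cvg_fst.
by apply: (@cvg_comp _ _ _ snd g); [exact: cvg_snd|exact: cg].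
Qed.

(** A partial derivative acts on a single factor, so tensor products of smooth functions are stable
    under it; this is the induction step for smoothness in R^3. *)
Lemma tensor_partial f g h (i : 'I_3) : smooth1 f -> smooth1 g -> smooth1 h ->
  (forall x, derivable (tensor f g h) x (basis_vect R i)) /\
  exists f' g' h', [/\ smooth1 f', smooth1 g', smooth1 h' &
    partial i (tensor f g h) = tensor f' g' h'].
Proof.
move=> sf sg sh.
have [f' df sf'] := smooth1_derive sf.
have [g' dg sg'] := smooth1_derive sg.
have [h' dh sh'] := smooth1_derive sh.
pose v := basis_vect R i.
have d01 (n m : nat) : ((n == m)%:R = 0 :> R) \/ ((n == m)%:R = 1 :> R).
  by case: eqP; [right|left].
have D x : is_derive x v (tensor f g h)
   ((f x.1.1 * g x.1.2) * (v.2 * h' x.2) + h x.2 *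
     (f x.1.1 * (v.1.2 * g' x.1.2) + g x.1.2 * (v.1.1 * f' x.1.1))).
  have d1 : is_derive x v (f \o (fun x : E3 => x.1.1)) (v.1.1 * f' x.1.1).
    by apply: (is_derive_coord (p := fun x => x.1.1)) => //; exact: d01.
  have d2 : is_derive x v (g \o (fun x : E3 => x.1.2)) (v.1.2 * g' x.1.2).
    by apply: (is_derive_coord (p := fun x => x.1.2)) => //; exact: d01.
  have d3 : is_derive x v (h \o (fun x : E3 => x.2)) (v.2 * h' x.2).
    by apply: (is_derive_coord (p := fun x => x.2)) => //; exact: d01.
  exact: (is_deriveM (is_deriveM d1 d2) d3).
split; first by move=> x; have [] := D x.
have P : partial i (tensor f g h) = fun x =>
    ((f x.1.1 * g x.1.2) * (v.2 * h' x.2) + h x.2 *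
     (f x.1.1 * (v.1.2 * g' x.1.2) + g x.1.2 * (v.1.1 * f' x.1.1))).
  by apply/funext => x; have [_] := D x.
rewrite P /v /basis_vect; case: i {v D P} => -[|[|[|//]]] /= _.
- exists f', g, h; split => //; apply/funext => x; rewrite /tensor; ring.
- exists f, g', h; split => //; apply/funext => x; rewrite /tensor; ring.
- exists f, g, h'; split => //; apply/funext => x; rewrite /tensor; ring.
Qed.

Lemma tensor_smooth f g h : smooth1 f -> smooth1 g -> smooth1 h ->
  smooth (tensor f g h).
Proof.
move=> sf sg sh s.
have [f' [g' [h' [sf' sg' sh' ->]]]] : exists f' g' h', [/\ smooth1 f',
    smooth1 g', smooth1 h' & partials s (tensor f g h) = tensor f' g' h'].
  elim: s => [|i s [f' [g' [h' [sf' sg' sh' /= ->]]]]].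
    by exists f, g, h.
  by have [] := tensor_partial i sf' sg' sh'.
split; first by apply: tensor_continuous; apply: smooth1_continuous.
by move=> i; have [] := tensor_partial i sf' sg' sh'.
Qed.

Lemma tensor_test_function (N : R) f g h : smooth1 f -> smooth1 g -> smooth1 h ->
  (forall x, N < `|x| -> f x = 0) -> (forall x, N < `|x| -> g x = 0) ->
  (forall x, N < `|x| -> h x = 0) -> test_function (tensor f g h).
Proof.
move=> sf sg sh f0 g0 h0; split; first exact: tensor_smooth.
have cK : compact ((`[-N, N] `*` `[-N, N]) `*` `[-N, N] : set E3).
  by do 2?apply: compact_setX; exact: segment_compact.
apply: (subclosed_compact (@closed_closure _ _) cK).
have clK := compact_closed (@norm_hausdorff R E3) cK.
rewrite [X in _ `<=` X]((closure_id _).1 clK); apply: closureS => x /=.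
rewrite /tensor !in_itv/= -!ler_norml => fgh0.
have H k y : (forall x, N < `|x| -> k x = 0) -> k y != 0 -> `|y| <= N.
  by move=> k0 ky; rewrite leNgt; apply: contra ky => /k0/eqP.
move: fgh0; rewrite !mulf_eq0 !negb_or => /andP[/andP[fx gx] hx].
by split; [split|]; [exact: H f0 fx|exact: H g0 gx|exact: H h0 hx].
Qed.

End Tensor.

(** * Uniqueness of weak derivatives *)

(** With the whole spaces among the generators, the strips [A x T2] and [T1 x B] are generated too,
    so both projections are measurable for the generated sigma-algebra. *)
Lemma measurable_prod_generated d1 d2 (T1 : measurableType d1)
    (T2 : measurableType d2) (C1 : set (set T1)) (C2 : set (set T2)) :
  d1.-measurable = <<s C1 >> -> d2.-measurable = <<s C2 >> ->
  C1 setT -> C2 setT ->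
  (d1, d2).-prod.-measurable = <<s [set A `*` B | A in C1 & B in C2] >>.
Proof.
move=> E1 E2 T_1 T_2; set G := [set A `*` B | A in C1 & B in C2].
have m1 A : C1 A -> d1.-measurable A by rewrite E1; exact: sub_sigma_algebra.
have m2 A : C2 A -> d2.-measurable A by rewrite E2; exact: sub_sigma_algebra.
apply/seteqP; split; last first.
  apply: smallest_sub; first exact: sigma_algebra_measurable.
  by move=> _ [A /m1 mA [B /m2 mB <-]]; exact: measurableX.
rewrite measurable_prod_measurableType.
apply: smallest_sub; first exact: smallest_sigma_algebra.
pose S := g_sigma_algebraType G.
have mfst : measurable_fun setT (fst : S -> T1).
  apply: (measurability _ E1) => _ [A CA <-]; apply: sub_sigma_algebra.
  by exists A => //; exists setT => //; rewrite setTI; apply/seteqP; split => x //= -[].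
have msnd : measurable_fun setT (snd : S -> T2).
  apply: (measurability _ E2) => _ [A CA <-]; apply: sub_sigma_algebra.
  by exists setT => //; exists A => //; rewrite setTI; apply/seteqP; split => x //= -[].
move=> _ [A mA [B mB <-]].
have -> : A `*` B = (setT `&` fst @^-1` A) `&` (setT `&` snd @^-1` B).
  by rewrite !setTI.
apply: (@measurableI _ S); first exact: (mfst measurableT _ mA).
exact: (msnd measurableT _ mB).
Qed.

(** * Square-integrable functions *)

Section LTwo.
Context d (T : measurableType d) (R : realType) (mu : {measure set T -> \bar R}).

Lemma Lnorm2_sqr (u : T -> R) :
  ('N[mu]_2%:E[EFin \o u] ^+ 2 = \int[mu]_x (`|u x| ^+ 2)%:E)%E.
Proof.
transitivity (('N[mu]_2%:E[EFin \o u] `^ 2)%E).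
  have := Lnorm_ge0 mu 2%:E (EFin \o u).
  case: ('N[mu]_2%:E[_])%E => [r| |//].
    by rewrite lee_fin => r0; rewrite poweR_EFin powR_mulrn// EFin_expe.
  by move=> _; rewrite poweRyr ?pnatr_eq0// expe2.
rewrite poweR_Lnorm ?pnatr_eq0//; apply: eq_integral => x _ /=.
by rewrite powR_mulrn.
Qed.

Lemma Lfun2P (u : T -> R) : u \in Lfun mu 2%:E <->
  measurable_fun setT u /\ (\int[mu]_x (`|u x| ^+ 2)%:E < +oo)%E.
Proof.
rewrite -Lnorm2_sqr inE; split.
  move=> /andP[]; rewrite !inE/= => mu2 fu; split => //.
  by rewrite /finite_norm in fu; rewrite lte_mul_pinfty// ?ge0_fin_numE// ?Lnorm_ge0.
move=> [mu2 fu]; apply/andP; rewrite !inE/=; split => //.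
rewrite /finite_norm ltNge leye_eq; apply/negP => /eqP N.
by move: fu; rewrite N.
Qed.
End LTwo.

(** * Orthants: a pi-system generating the sigma-algebra of R^3 *)

Section Rays.
Variable R : realType.

(** [None] adds the whole line, which both the product of generators and the pi-lambda argument
    require; the family stays closed under intersection. *)
Definition ray (o : option R) : set (measurableTypeR R) :=
  if o is Some a then `]a, +oo[ else setT.

Lemma measurable_ray o : measurable (ray o).
Proof. by case: o => [a|] /=; [exact: measurable_itv|exact: measurableT]. Qed.

Lemma measurable_generated_ray :
  @measurable _ (measurableTypeR R) = <<s range ray >>.
Proof.
rewrite [LHS](RGenOInfty.measurableE R); apply/seteqP; split.
  apply: smallest_sub; first exact: smallest_sigma_algebra.
  by move=> _ [a ->]; apply: sub_gen_smallest; exists (Some a).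
rewrite -[X in _ `<=` X](RGenOInfty.measurableE R).
apply: smallest_sub; first exact: sigma_algebra_measurable.
by move=> _ [q _ <-]; exact: measurable_ray.
Qed.

Lemma setI_closed_ray : setI_closed (range ray).
Proof.
move=> _ _ [[a|] _ <-] [[b|] _ <-]; last 3 first.
- by exists (Some a); rewrite //= setIT.
- by exists (Some b); rewrite //= setTI.
- by exists None; rewrite //= setTI.
exists (Some (Num.max a b)) => //=; apply/seteqP; split => x /=; rewrite !in_itv/= !andbT.
  by rewrite gt_max => /andP[].
by rewrite gt_max => -[-> ->].
Qed.

Definition ray3 (o : option R * option R * option R) :
    set (measurableTypeR R * measurableTypeR R * measurableTypeR R)%type :=
  (ray o.1.1 `*` ray o.1.2) `*` ray o.2.

Lemma measurable_ray3 o : measurable (ray3 o).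
Proof.
by apply: measurableX; [apply: measurableX|]; exact: measurable_ray.
Qed.

Lemma measurable_generated_ray3 :
  @measurable _ (measurableTypeR R * measurableTypeR R * measurableTypeR R)%type
  = <<s range ray3 >>.
Proof.
have gT : (range ray) setT by exists None.
rewrite [LHS](measurable_prod_generated
   (measurable_prod_generated measurable_generated_ray measurable_generated_ray gT gT)
   measurable_generated_ray _ gT); last first.
  by exists setT => //; exists setT => //; rewrite setXTT.
congr (<<s _ >>); apply/seteqP; split.
  move=> _ [_ [_ [q1 _ <-] [_ [q2 _ <-] <-]] [_ [q3 _ <-] <-]].
  by exists (q1, q2, q3).
move=> _ [q _ <-]; exists (ray q.1.1 `*` ray q.1.2).
  by exists (ray q.1.1) => //; exists (ray q.1.2).
by exists (ray q.2).
Qed.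

Lemma setI_closed_ray3 : setI_closed (range ray3).
Proof.
have RI o o' : exists o'', ray o `&` ray o' = ray o''.
  have [q2 _ <-] := setI_closed_ray (imageP ray (I : setT o)) (imageP ray (I : setT o')).
  by exists q2.
move=> _ _ [q _ <-] [q2 _ <-].
have [r1 e1] := RI q.1.1 q2.1.1; have [r2 e2] := RI q.1.2 q2.1.2.
have [r3 e3] := RI q.2 q2.2.
by exists (r1, r2, r3) => //; rewrite /ray3 -!setXI e1 e2 e3.
Qed.

End Rays.

(** * Smooth approximations of orthants, and cutoffs *)

Section DuBoisReymond.
Variable R : realType.
Notation T3 := (measurableTypeR R * measurableTypeR R * measurableTypeR R)%type.
Notation E3 := (R * R * R)%type.
Notation mu := (@lebesgue_measure3 R).

Lemma flat1E (k x : R) : flat k 1 x = if 0 < x then expR (- (k * x^-1)) else 0.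
Proof. by rewrite /flat; case: ifP => // _; rewrite hornerC mul1r. Qed.

Lemma flat1_ge0 (k x : R) : 0 <= flat k 1 x.
Proof. by rewrite flat1E; case: ifP => // _; exact: expR_ge0. Qed.

Lemma flat1_gt0 (k x : R) : 0 < x -> 0 < flat k 1 x.
Proof. by rewrite flat1E => ->; exact: expR_gt0. Qed.

Lemma flat1_le1 (k x : R) : 0 < k -> flat k 1 x <= 1.
Proof.
move=> k0; rewrite flat1E; case: ifPn => // x0.
by rewrite -expR0 ler_expR oppr_le0; apply: mulr_ge0; rewrite ?invr_ge0 ltW.
Qed.

Lemma flat1_eq0 (k x : R) : x <= 0 -> flat k 1 x = 0.
Proof. by rewrite flat1E ltNge => ->. Qed.

(** On [x > a] this is [exp(-1/((n+1)(x - a)))], a smooth function that increases to 1 with [n]; the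
    form [1 * x + - a] fits [Ck_affine]. *)
Definition soft_ray (o : option R) (n : nat) (x : R) : R :=
  if o is Some a then flat n.+1%:R^-1 1 (1 * x + - a) else 1.

Lemma smooth1_soft_ray o n : smooth1 (soft_ray o n).
Proof.
case: o => [a|] m /=; last exact: Ck_cst.
by apply: Ck_affine; apply: smooth1_flat; rewrite invr_gt0.
Qed.

Lemma soft_ray_ge0 o n x : 0 <= soft_ray o n x.
Proof. by case: o => [a|] //=; exact: flat1_ge0. Qed.

Lemma soft_ray_le1 o n x : soft_ray o n x <= 1.
Proof. by case: o => [a|] //=; apply: flat1_le1; rewrite invr_gt0. Qed.

Lemma soft_ray_cvg o x : soft_ray o n x @[n --> \oo] --> (\1_(ray o) x : R).
Proof.
case: o => [a|] /=; last by rewrite indicT; exact: cvg_cst.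
rewrite indicE; case: (ltP a x) => ax; last first.
  rewrite memNset/=; last by rewrite in_itv/= andbT; apply/negP; rewrite -leNgt.
  apply: cvg_near_cst; near=> n.
  by rewrite flat1_eq0// mul1r subr_le0.
rewrite mem_set/=; last by rewrite in_itv/= andbT.
rewrite (_ : (fun n => _) = (fun n => expR (- (n.+1%:R^-1 * (x - a)^-1)))); last first.
  by apply/funext => n; rewrite mul1r flat1E subr_gt0 ax.
have H : - (n.+1%:R^-1 * (x - a)^-1) @[n --> \oo] --> - (0 * (x - a)^-1).
  apply: cvgN; apply: cvgM; [exact: cvg_harmonic|exact: cvg_cst].
have := continuous_cvg _ (@continuous_expR R _) H.
by rewrite mul0r oppr0 expR0; exact.
Unshelve. all: by end_near. Qed.

(** A smooth bump, positive exactly on []-N, N[]: positivity is what permits dividing it out of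
    [g * eta = 0]. *)
Definition cutoff (N x : R) : R := flat 1 1 (1 * x + N) * flat 1 1 (- 1 * x + N).

Lemma smooth1_cutoff N : smooth1 (cutoff N).
Proof. by move=> n; apply: CkM; apply: Ck_affine; exact: smooth1_flat. Qed.

Lemma cutoff_ge0 N x : 0 <= cutoff N x.
Proof. by rewrite mulr_ge0 ?flat1_ge0. Qed.

Lemma cutoff_le1 N x : cutoff N x <= 1.
Proof. by rewrite mulr_ile1 ?flat1_ge0 ?flat1_le1. Qed.

Lemma cutoff_gt0 N x : `|x| < N -> 0 < cutoff N x.
Proof.
rewrite ltr_norml => /andP[h1 h2]; apply: mulr_gt0; apply: flat1_gt0; lra.
Qed.

Lemma cutoff_eq0 N x : N < `|x| -> cutoff N x = 0.
Proof.
rewrite ltNge ler_norml negb_and -!ltNge => /orP[h|h]; rewrite /cutoff.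
  by rewrite [X in X * _]flat1_eq0 ?mul0r//; lra.
by rewrite [X in _ * X]flat1_eq0 ?mulr0//; lra.
Qed.

(** The square is dominated by the indicator of the cube [[-N, N]^3], of finite measure. *)
Lemma tensor_Lfun2 (N : R) (f g h : R -> R) :
  continuous f -> continuous g -> continuous h ->
  (forall x, `|f x| <= 1) -> (forall x, `|g x| <= 1) -> (forall x, `|h x| <= 1) ->
  (forall x, N < `|x| -> f x = 0) -> (forall x, N < `|x| -> g x = 0) ->
  (forall x, N < `|x| -> h x = 0) ->
  (tensor f g h : T3 -> R) \in Lfun mu 2%:E.
Proof.
move=> cf cg ch f1 g1 h1 f0 g0 h0.
have mt : measurable_fun setT (tensor f g h : T3 -> R).
  by apply: continuous_measurable3; exact: tensor_continuous.
apply/Lfun2P; split => //.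
pose I : set (measurableTypeR R) := `[- N, N]%classic.
pose K : set T3 := (I `*` I) `*` I.
have mI : measurable I by exact: measurable_itv.
have mK : measurable K by do 2 apply: measurableX => //.
have Ioo : (@lebesgue_measure R I < +oo)%E.
  by rewrite lebesgue_measure_itv/=; case: ifPn => _; rewrite -?EFinD ltry.
apply: (@le_lt_trans _ _ (\int[mu]_x (\1_K x)%:E)%E); last first.
  rewrite integral_indic// setIT /K [X in (X < _)%E](_ : _ =
    @lebesgue_measure R I * @lebesgue_measure R I * @lebesgue_measure R I)%E.
    have I0 : (0 <= @lebesgue_measure R I)%E by [].
    have If : @lebesgue_measure R I \is a fin_num by rewrite ge0_fin_numE.
    by rewrite lte_mul_pinfty ?mule_ge0// fin_numM.
  apply: eq_trans.
    exact: (product_measure1E (@lebesgue_measure2 R) (@lebesgue_measure R)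
      (measurableX mI mI) mI).
  congr (_ * _)%E.
  exact: (product_measure1E (@lebesgue_measure R) (@lebesgue_measure R) mI mI).
apply: ge0_le_integral => //.
- by apply/measurable_EFinP; apply: measurable_funX; exact: measurableT_comp.
- by apply/measurable_EFinP.
move=> [[x y] z] _; rewrite lee_fin indicE.
have [|/negP nK] := boolP ((x, y, z) \in K).
  rewrite /tensor/= normrM normrM exprn_ile1// ?mulr_ge0//.
  by rewrite !mulr_ile1 ?mulr_ge0.
rewrite /tensor/=; have [Nx|Nx] := ltP N `|x|; first by rewrite f0// !mul0r normr0 expr0n.
have [Ny|Ny] := ltP N `|y|; first by rewrite g0// mulr0 mul0r normr0 expr0n.
have [Nz|Nz] := ltP N `|z|; first by rewrite h0// mulr0 normr0 expr0n.
exfalso; apply: nK; apply/mem_set; split; [split|]; rewrite /= /I/= in_itv/= -ler_norml//.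
Qed.

End DuBoisReymond.

(** The sets over which [h] integrates to 0 form a Dynkin system: [setT] handles complements, and
    integrability of [h] handles countable disjoint unions. *)
Lemma integral_eq0_generated d (T : measurableType d) (R : realType)
    (mu : {measure set T -> \bar R}) (G : set (set T)) (h : T -> \bar R) :
  d.-measurable = <<s G >> -> setI_closed G -> G setT ->
  mu.-integrable setT h ->
  (forall A, G A -> (\int[mu]_(x in A) h x = 0)%E) ->
  forall A, measurable A -> (\int[mu]_(x in A) h x = 0)%E.
Proof.
move=> GE GI GT ih hG A mA.
have mh : measurable_fun setT h by exact: measurable_int ih.
apply: (dynkin_induction (G := G)
  (P := fun A => (\int[mu]_(x in A) h x = 0)%E) GE GI) => //.
- exact: hG.
- move=> S mS hS.
  have mSC := measurableC mS.
  have := hG _ GT; rewrite -(setUv S) integral_setU//; last 2 first.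
  + by rewrite setUv.
  + by apply/disj_setPS; rewrite setICr.
  by rewrite [X in (X + _)%E]hS add0e.
- move=> F mF tF hF; rewrite integral_bigcup//.
    by apply: eseries0 => n _ _; exact: hF.
  by apply: integrableS ih => //; exact: bigcup_measurable.
- by rewrite -GE.
Qed.

Section DuBoisReymond.
Variable R : realType.
Notation T3 := (measurableTypeR R * measurableTypeR R * measurableTypeR R)%type.
Notation E3 := (R * R * R)%type.
Notation mu := (@lebesgue_measure3 R).

(* Testing g against eta times smooth approximations of the indicator of an
   orthant shows that the integral of g * eta vanishes on the pi-system of
   orthants, for every cutoff eta. *)
Lemma ae_eq0_of_test_functions (g : R3 R -> R) : (g : T3 -> R) \in Lfun mu 2%:E ->
  (forall phi : R3 R -> R, test_function phi -> (phi : T3 -> R) \in Lfun mu 2%:E ->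
    \int[mu]_x (g x * phi x) = 0) ->
  {ae mu, forall x, g x = 0}.
Proof.
move=> g2 g0.
have mg : measurable_fun setT (g : T3 -> R) by have /Lfun2P[] := g2.
pose eta (N : nat) : E3 -> R := tensor (cutoff N%:R) (cutoff N%:R) (cutoff N%:R).
have cc N := smooth1_continuous (@smooth1_cutoff R N).
have norm1 (x : R) : 0 <= x -> x <= 1 -> `|x| <= 1 by move=> x0 x1; rewrite ger0_norm.
have eta2 N : (eta N : T3 -> R) \in Lfun mu 2%:E.
  have c1 x : `|cutoff N%:R x : R| <= 1.
    by apply: norm1; [exact: cutoff_ge0|exact: cutoff_le1].
  by apply: (@tensor_Lfun2 R N%:R) => //; exact: cutoff_eq0.
have ih N : mu.-integrable setT (EFin \o (fun x : T3 => g x * eta N x)).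
  by apply/Lfun1_integrable; exact: Lfun2_mul_Lfun1.
have key N (q : option R * option R * option R) :
    (\int[mu]_(x in ray3 q) (g x * eta N x)%:E = 0)%E.
  pose th n : E3 -> R := tensor (soft_ray q.1.1 n) (soft_ray q.1.2 n) (soft_ray q.2 n).
  pose f n (x : T3) : \bar R := (g x * eta N x * th n x)%:E.
  have f0 n : (\int[mu]_x f n x = 0)%E.
    (* Cutoff and soft ray are multiplied coordinate by coordinate, so that [eta N * th n] is again
       a tensor product, hence a test function. *)
    pose c (s : option R) (x : R) := cutoff N%:R x * soft_ray s n x.
    have sc s : smooth1 (c s).
      by move=> m; apply: CkM; [exact: smooth1_cutoff|exact: smooth1_soft_ray].
    have c0 s x : N%:R < `|x| -> c s x = 0 by move=> /cutoff_eq0; rewrite /c => ->; rewrite mul0r.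
    have c1 s x : `|c s x| <= 1.
      apply: norm1; first by rewrite mulr_ge0 ?cutoff_ge0 ?soft_ray_ge0.
      by rewrite mulr_ile1 ?cutoff_ge0 ?soft_ray_ge0 ?cutoff_le1 ?soft_ray_le1.
    pose phi := tensor (c q.1.1) (c q.1.2) (c q.2).
    have phit : test_function phi by apply: (@tensor_test_function R N%:R) => //; exact: c0.
    have phi2 : (phi : T3 -> R) \in Lfun mu 2%:E.
      by apply: (@tensor_Lfun2 R N%:R) => //; try exact: c0;
        apply: smooth1_continuous; exact: sc.
    have gphi : f n = EFin \o (fun x : T3 => g x * phi x).
      apply/funext => x; rewrite /f /= /eta /th /phi /tensor /c; congr EFin; ring.
    have igphi : mu.-integrable setT (EFin \o (fun x : T3 => g x * phi x)).
      by apply/Lfun1_integrable; exact: Lfun2_mul_Lfun1.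
    rewrite gphi -[LHS]fineK; last exact: integrable_fin_num.
    congr EFin; exact: (g0 phi).
  have meta : measurable_fun setT (eta N : T3 -> R) by have /Lfun2P[] := eta2 N.
  have mth n : measurable_fun setT (th n : T3 -> R).
    by apply: continuous_measurable3; apply: tensor_continuous;
      apply: smooth1_continuous; exact: smooth1_soft_ray.
  have mgeta : measurable_fun setT (fun x : T3 => g x * eta N x).
    by apply: measurable_funM.
  have [] := @dominated_convergence _ _ _ mu setT measurableT f
    (fun x => (g x * eta N x * \1_(ray3 q) x)%:E) (fun x => `|g x * eta N x|%:E).
  - by move=> n; apply/measurable_EFinP; apply: measurable_funM.
  - by apply/measurable_EFinP; apply: measurable_funM => //;
      apply: measurable_indic; exact: measurable_ray3.
  - apply/aeW => x _; rewrite /f; apply: cvg_EFin; first exact: nearW.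
    apply: cvgM; first exact: cvg_cst.
    have -> : \1_(ray3 q) x = \1_(ray q.1.1) x.1.1 * \1_(ray q.1.2) x.1.2 * \1_(ray q.2) x.2 :> R.
      rewrite !indicE -!natrM !mulnb; congr (_%:R); congr nat_of_bool.
      apply/idP/idP => [/set_mem[[h1 h2] h3]|/andP[/andP[/set_mem h1 /set_mem h2] /set_mem h3]].
        by rewrite !mem_set.
      by apply/mem_set.
    by apply: cvgM; [apply: cvgM|]; exact: soft_ray_cvg.
  - by have /integrable_abse := ih N.
  - apply/aeW => x n _; rewrite /f /= lee_fin normrM ler_piMr//.
    rewrite ger0_norm; last by rewrite !mulr_ge0 ?soft_ray_ge0.
    by rewrite !mulr_ile1 ?mulr_ge0 ?soft_ray_ge0 ?soft_ray_le1.
  move=> _ _ cvf.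
  transitivity (\int[mu]_x (g x * eta N x * \1_(ray3 q) x)%:E)%E.
    rewrite integral_mkcond; apply: eq_integral => x _.
    rewrite patchE indicE; case: ifPn => _; first by rewrite mulr1.
    by rewrite mulr0.
  apply: (cvg_unique _ cvf) => //.
  by apply: cvg_near_cst; apply: nearW => n; exact: f0.
have h0 N : {ae mu, forall x, g x * eta N x = 0}.
  have : ae_eq mu setT (fun x : T3 => (g x * eta N x)%:E) (cst 0%E).
    apply: integral_ae_eq => //; first exact: ih.
    move=> A _ mA; rewrite integral0.
    apply: (integral_eq0_generated (@measurable_generated_ray3 R)
      (@setI_closed_ray3 R) _ (ih N)) => //.
      by exists (None, None, None) => //; rewrite /ray3/= !setXTT.
    by move=> _ [q _ <-]; exact: key.
  by apply: filterS => x /(_ I) [].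
(* Off one null set all the products [g * eta N] vanish. Any [N] above the sum of the moduli of the
   coordinates puts [x] where [eta N] is positive. *)
have := ae_foralln h0; apply: filterS => x gx.
pose M := `|x.1.1| + `|x.1.2| + `|x.2|.
have [N MN] : exists N : nat, M < N%:R.
  by exists (Num.truncn M).+1; rewrite truncnS_gt.
have := gx N; move/eqP; rewrite mulf_eq0 => /orP[/eqP//|].
rewrite gt_eqF// /eta /tensor.
have h1 := normr_ge0 x.1.1; have h2 := normr_ge0 x.1.2; have h3 := normr_ge0 x.2.
by apply: mulr_gt0; [apply: mulr_gt0|]; apply: cutoff_gt0; apply: le_lt_trans MN; rewrite /M; lra.
Qed.

End DuBoisReymond.

Lemma ae_mono d (T : measurableType d) (R : realType)
    (mu : {measure set T -> \bar R}) (P Q : T -> Prop) :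
  (forall x, P x -> Q x) -> {ae mu, forall x, P x} -> {ae mu, forall x, Q x}.
Proof. by move=> PQ; apply: filterS. Qed.

Lemma ae_forall_fin d (T : measurableType d) (R : realType)
    (mu : {measure set T -> \bar R}) (I : finType) (P : I -> T -> Prop) :
  (forall i, {ae mu, forall x, P i x}) -> {ae mu, forall x, forall i, P i x}.
Proof. exact: filter_forall. Qed.

(** * Weak derivatives: uniqueness and rescaling *)

Section WeakPartial.
Variable R : realType.
Notation T3 := (measurableTypeR R * measurableTypeR R * measurableTypeR R)%type.
Notation E3 := (R * R * R)%type.
Notation mu := (@lebesgue_measure3 R).
Implicit Types (u g phi : R3 R -> R).

Lemma weak_partial_unique i u g1 g2 : weak_partial i u g1 ->
  weak_partial i u g2 -> {ae mu, forall x, g1 x = g2 x}.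
Proof.
move=> [g12 wg1] [g22 wg2].
have g2' : (fun x => g1 x - g2 x : R) \in Lfun mu 2%:E.
  have p1 : (1 <= 2%:E :> \bar R)%E by rewrite lee_fin ler1n.
  have [_ /(_ (- 1) g2 g1 g22 g12)] := Lfun_submod_closed mu p1.
  by rewrite scaleN1r addrC.
have : {ae mu, forall x, g1 x - g2 x = 0}.
  apply: (ae_eq0_of_test_functions g2') => phi tphi phi2.
  have i1 : mu.-integrable setT (EFin \o (fun x => g1 x * phi x)).
    by apply/Lfun1_integrable; exact: Lfun2_mul_Lfun1.
  have i2 : mu.-integrable setT (EFin \o (fun x => g2 x * phi x)).
    by apply/Lfun1_integrable; exact: Lfun2_mul_Lfun1.
  under eq_Rintegral do rewrite mulrBl.
  rewrite RintegralB//; apply/eqP; rewrite subr_eq0 -eqr_opp.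
  by rewrite -wg1// -wg2.
apply: ae_mono => x h.
by apply/eqP; rewrite -subr_eq0; apply/eqP.
Qed.

Lemma RintegralZl_gt0 (k : R) (f : R3 R -> R) : 0 < k ->
  measurable_fun setT (f : T3 -> R) ->
  \int[mu]_x (k * f x) = k * \int[mu]_x f x.
Proof.
move=> k0 mf.
have mE : measurable_fun setT (EFin \o (f : T3 -> R)) by apply/measurable_EFinP.
rewrite /Rintegral -fine_pmule//; congr fine.
rewrite integralE [in RHS]integralE pmuleBr//.
have kp := ge0_integralZl_EFin (D := setT) mu measurableT
  (fun x _ => funepos_ge0 (EFin \o f) x) (measurable_funepos mE) (ltW k0).
have kn := ge0_integralZl_EFin (D := setT) mu measurableT
  (fun x _ => funeneg_ge0 (EFin \o f) x) (measurable_funeneg mE) (ltW k0).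
rewrite -[X in _ = (X - _)%E]kp -[X in _ = (_ - X)%E]kn.
by congr (_ - _)%E; apply: eq_integral => x _;
  rewrite ?funeposE ?funenegE EFinM -?muleN maxe_pMr ?mule0 ?lee_fin ?ltW.
Qed.

(** Amplitude and dilation at once: [s = t^(3/2)], [r = t] is [dilation], while [r = 1] changes the
    mass only. *)
Definition rescale (s r : R) u : R3 R -> R := fun x => s * u (scale3 r x).

Lemma measurable_comp_scale3 r (f : R3 R -> R) :
  measurable_fun setT (f : T3 -> R) ->
  measurable_fun setT (f \o scale3 r : T3 -> R).
Proof. by move=> mf; apply: measurableT_comp => //; exact: measurable_scale3. Qed.

Lemma measurable_comp_scale3e r (f : R3 R -> \bar R) :
  measurable_fun setT (f : T3 -> \bar R) ->
  measurable_fun setT (f \o scale3 r : T3 -> \bar R).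
Proof. by move=> mf; apply: measurableT_comp => //; exact: measurable_scale3. Qed.

Lemma measurable_rescale s r u : measurable_fun setT (u : T3 -> R) ->
  measurable_fun setT (rescale s r u : T3 -> R).
Proof. by move=> mu_; apply: measurable_funM => //; exact: measurable_comp_scale3. Qed.

Lemma integral_rescale_expr (n : nat) s r u : 0 < s -> 0 < r ->
  measurable_fun setT (u : T3 -> R) ->
  (\int[mu]_x (`|rescale s r u x| ^+ n)%:E =
   (s ^+ n * r ^- 3)%:E * \int[mu]_x (`|u x| ^+ n)%:E)%E.
Proof.
move=> s0 r0 mu_.
have mun : measurable_fun setT (fun x : T3 => (`|u x| ^+ n)%:E).
  by apply/measurable_EFinP; apply: measurable_funX; exact: measurableT_comp.
rewrite mulrC EFinM -muleA -ge0_integralZl_EFin//; last first.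
  by rewrite exprn_ge0// ltW.
rewrite -ge0_integral_scale3//.
- by apply: eq_integral => x _; rewrite /rescale normrM gtr0_norm// exprMn EFinM.
- exact: emeasurable_funM.
- by move=> x; rewrite mule_ge0 ?lee_fin ?exprn_ge0// ltW.
Qed.

Lemma Lfun2_rescale s r u : 0 < s -> 0 < r -> u \in Lfun mu 2%:E ->
  rescale s r u \in Lfun mu 2%:E.
Proof.
move=> s0 r0 /Lfun2P[mu_ u2]; apply/Lfun2P; split.
  exact: measurable_rescale.
rewrite integral_rescale_expr//; apply: lte_mul_pinfty => //.
by rewrite lee_fin divr_ge0// exprn_ge0// ltW.
Qed.

Lemma weak_partial_rescale i s r u g : 0 < s -> 0 < r ->
  measurable_fun setT (u : T3 -> R) ->
  weak_partial i u g -> weak_partial i (rescale s r u) (rescale (s * r) r g).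
Proof.
move=> s0 r0 mu_ [g2 wg]; split; first exact: Lfun2_rescale (mulr_gt0 s0 r0) r0 g2.
move=> phi tphi.
have r10 : 0 < r^-1 by rewrite invr_gt0.
(* The dilation is moved to the test function: after the change of variables [u] is tested against
   [psi], and the factor [r^-1] of its derivative accounts for [s * r]. *)
pose psi := phi \o scale3 r^-1.
have tpsi : test_function psi by exact: test_function_scale3.
have psiE x : psi (scale3 r x) = phi x by rewrite /psi /= scale3K.
have dpsiE x : partial i psi (scale3 r x) = r^-1 * partial i phi x.
  have /(congr1 (@^~ (scale3 r x))) := partials_scale3 [:: i] r10 tphi.1.
  by rewrite /= => ->; rewrite expr1 scale3K.
have mg : measurable_fun setT (g : T3 -> R) by have /Lfun2P[] := g2.
have mpsi : measurable_fun setT (psi : T3 -> R).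
  by apply: continuous_measurable3; exact: (tpsi.1 [::]).1.
have mdpsi : measurable_fun setT (partial i psi : T3 -> R).
  by apply: continuous_measurable3; exact: (tpsi.1 [:: i]).1.
have sr0 : 0 < s * r by rewrite mulr_gt0.
have mud : measurable_fun setT (fun x : T3 => u x * partial i psi x).
  exact: measurable_funM.
have mgp : measurable_fun setT (fun x : T3 => g x * psi x).
  exact: measurable_funM.
transitivity (\int[mu]_x ((s * r) * (u (scale3 r x) * partial i psi (scale3 r x)))).
  apply: eq_Rintegral => x _; rewrite dpsiE /rescale.
  by field; rewrite gt_eqF.
rewrite (Rintegral_scale3 (f := fun x => (s * r) * (u x * partial i psi x)))//; last first.
  exact: measurable_funM.
rewrite RintegralZl_gt0// wg//.
transitivity (- \int[mu]_x ((s * r) * (g (scale3 r x) * psi (scale3 r x)))); last first.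
  congr (- _); apply: eq_Rintegral => x _; rewrite psiE /rescale; ring.
rewrite (Rintegral_scale3 (f := fun x => (s * r) * (g x * psi x)))//; last first.
  exact: measurable_funM.
by rewrite RintegralZl_gt0// !mulrN.
Qed.

Lemma H1_measurable u : H1 u -> measurable_fun setT (u : T3 -> R).
Proof. by move=> [/Lfun2P[]]. Qed.

Lemma H1_rescale s r u : 0 < s -> 0 < r -> H1 u -> H1 (rescale s r u).
Proof.
move=> s0 r0 Hu; have mu_ := H1_measurable Hu.
case: Hu => u2 gu; split; first exact: Lfun2_rescale.
move=> i; have [g wg] := gu i; exists (rescale (s * r) r g).
exact: weak_partial_rescale.
Qed.

Lemma gradP u i : H1 u -> weak_partial i u (grad u i).
Proof. by move=> [_ /(_ i)[g wg]]; rewrite /grad; case: xgetP => [h -> //|/(_ g)]. Qed.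

Lemma measurable_grad u i : H1 u -> measurable_fun setT (grad u i : T3 -> R).
Proof. by move=> /(gradP i)[/Lfun2P[]]. Qed.

Lemma measurable_sum_grad u : H1 u ->
  measurable_fun setT (fun x : T3 => (\sum_(i < 3) `|grad u i x| ^+ 2)).
Proof.
move=> Hu; apply: measurable_sum => i; apply: measurable_funX.
by apply: measurableT_comp => //; exact: measurable_grad.
Qed.

Lemma dirichlet_rescale s r u : 0 < s -> 0 < r -> H1 u ->
  dirichlet (rescale s r u) = ((s ^+ 2 / r)%:E * dirichlet u)%E.
Proof.
move=> s0 r0 Hu; have Hsu := H1_rescale s0 r0 Hu.
have sr0 : 0 < s * r by rewrite mulr_gt0.
have ms := measurable_sum_grad Hu.
pose f (x : T3) : \bar R := (((s * r) ^+ 2)%:E * (\sum_(i < 3) `|grad u i x| ^+ 2)%:E)%E.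
have mf : measurable_fun setT f.
  by apply: emeasurable_funM => //; exact/measurable_EFinP.
have sum0 (x : T3) : setT x -> (0 <= (\sum_(i < 3) `|grad u i x| ^+ 2)%:E)%E.
  by move=> _; rewrite lee_fin sumr_ge0// => i _; rewrite exprn_ge0.
have f0 x : (0 <= f x)%E.
  by apply: mule_ge0; [rewrite lee_fin exprn_ge0// ltW|exact: sum0].
transitivity (\int[mu]_x f (scale3 r x))%E; last first.
  rewrite ge0_integral_scale3//.
  rewrite (ge0_integralZl_EFin mu measurableT sum0 _ (exprn_ge0 2 (ltW sr0))); last first.
    exact/measurable_EFinP.
  by rewrite muleA -EFinM; congr (_%:E * _)%E; field; rewrite gt_eqF.
apply: ge0_ae_eq_integral => //.
- by apply/measurable_EFinP; exact: measurable_sum_grad.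
- by apply: measurableT_comp => //; exact: measurable_scale3.
- by move=> x _; rewrite lee_fin sumr_ge0// => i _; rewrite exprn_ge0.
(* The rescaled [grad u i] is one weak derivative of the rescaled function, and the one chosen by
   [grad] agrees with it almost everywhere, which is enough under the integral. *)
have ae i : {ae mu, forall x, grad (rescale s r u) i x = rescale (s * r) r (grad u i) x}.
  apply: weak_partial_unique (gradP i Hsu) _.
  by apply: weak_partial_rescale => //; [exact: H1_measurable|exact: gradP].
move: (ae_forall_fin ae); apply: ae_mono => x h _.
rewrite /f -EFinM; congr EFin; rewrite mulr_sumr; apply: eq_bigr => i _.
by rewrite h /rescale normrM gtr0_norm// exprMn.
Qed.

End WeakPartial.

(** * The functionals along dilations *)

Section Hartree.
Variable R : realType.
Notation T3 := (measurableTypeR R * measurableTypeR R * measurableTypeR R)%type.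
Notation mu := (@lebesgue_measure3 R).
Implicit Types (u : R3 R -> R).

Lemma measurable_inv_eucl_dist : measurable_fun setT
  (fun p : T3 * T3 => (eucl_dist p.1 p.2)^-1).
Proof.
pose q (p : T3 * T3) : R :=
  (p.1.1.1 - p.2.1.1) ^+ 2 + (p.1.1.2 - p.2.1.2) ^+ 2 + (p.1.2 - p.2.2) ^+ 2.
have q0 p : 0 <= q p by rewrite !addr_ge0// sqr_ge0.
(* Root and inverse are written as powers, which are measurable; at 0 the conventions for [0^-1] and
   for the power [-1] agree. *)
rewrite (_ : (fun p => _) = (fun p : T3 * T3 => (q p `^ 2^-1) `^ (-1))); last first.
  by apply/funext => p; rewrite powR_inv1 ?powR_ge0// powR12_sqrt.
have m1 := measurable_fst : measurable_fun setT (fst : T3 * T3 -> T3).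
have m2 := measurable_snd : measurable_fun setT (snd : T3 * T3 -> T3).
have mq : measurable_fun setT q.
  apply: measurable_funD; first apply: measurable_funD.
  - by apply: measurable_funX; apply: measurable_funB; do 2 apply: measurableT_comp => //.
  - by apply: measurable_funX; apply: measurable_funB; do 2 apply: measurableT_comp => //.
  - by apply: measurable_funX; apply: measurable_funB; apply: measurableT_comp => //.
apply: (measurableT_comp (measurable_powR (-1))).
exact: (measurableT_comp (measurable_powR 2^-1)).
Qed.

Lemma eucl_dist_ge0 (x y : R3 R) : 0 <= eucl_dist x y.
Proof. exact: sqrtr_ge0. Qed.

Lemma eucl_dist_scale3 r (x y : R3 R) : 0 < r ->
  eucl_dist (scale3 r x) (scale3 r y) = r * eucl_dist x y.
Proof.
move=> r0; rewrite /eucl_dist /eucl_norm /= -[in RHS](ger0_norm (ltW r0)) -sqrtr_sqr.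
by rewrite -sqrtrM ?sqr_ge0//; congr Num.sqrt; ring.
Qed.

Definition hartree_density u (p : T3 * T3) : \bar R :=
  (`|u p.1| ^+ 2 * `|u p.2| ^+ 2 / eucl_dist p.1 p.2)%:E.

Lemma hartree_density_ge0 u p : (0 <= hartree_density u p)%E.
Proof.
by rewrite lee_fin divr_ge0 ?eucl_dist_ge0// mulr_ge0 ?exprn_ge0.
Qed.

Lemma measurable_hartree_density u : measurable_fun setT (u : T3 -> R) ->
  measurable_fun setT (hartree_density u).
Proof.
move=> mu_; have mu2 : measurable_fun setT (fun x : T3 => `|u x| ^+ 2).
  by apply: measurable_funX; exact: measurableT_comp.
apply/measurable_EFinP; apply: measurable_funM; last exact: measurable_inv_eucl_dist.
apply: measurable_funM.
  exact: (measurableT_comp mu2 measurable_fst).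
exact: (measurableT_comp mu2 measurable_snd).
Qed.

Lemma measurable_hartree_inner u : measurable_fun setT (u : T3 -> R) ->
  measurable_fun setT (fun x : T3 => \int[mu]_y hartree_density u (x, y))%E.
Proof.
move=> mu_.
exact: (@measurable_fun_fubini_tonelli_F _ _ _ _ _ _ (hartree_density u)
  (measurable_hartree_density mu_) (hartree_density_ge0 u)).
Qed.

(** The four factors [u] give [s^4], the kernel gives [r], and the two changes of variables give
    [r^-3] each. *)
Lemma hartree_rescale s r u : 0 < s -> 0 < r ->
  measurable_fun setT (u : T3 -> R) ->
  hartree (rescale s r u) = ((s ^+ 4 / r ^+ 5)%:E * hartree u)%E.
Proof.
move=> s0 r0 mu_.
have k0 : 0 <= s ^+ 4 * r by rewrite mulr_ge0 ?exprn_ge0 ?ltW.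
have r30 : 0 <= r ^- 3 by rewrite invr_ge0 exprn_ge0// ltW.
have mH := measurable_hartree_density mu_.
have H0 := hartree_density_ge0 u.
pose I (x : T3) : \bar R := (\int[mu]_y hartree_density u (x, y))%E.
have mI : measurable_fun setT I := measurable_hartree_inner mu_.
have I0 x : (0 <= I x)%E by apply: integral_ge0 => y _; exact: H0.
have mHx x : measurable_fun setT (fun y : T3 => hartree_density u (x, y)).
  exact: measurable_fun_pair2.
transitivity (\int[mu]_x ((s ^+ 4 * r)%:E * ((r ^- 3)%:E * I (scale3 r x))))%E.
  apply: eq_integral => x _.
  rewrite /I -(ge0_integral_scale3 r0 (mHx (scale3 r x)) (fun y => H0 _)).
  have mc : measurable_fun setT (fun y : T3 => hartree_density u (scale3 r x, scale3 r y)).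
    exact: (measurable_comp_scale3e r (mHx (scale3 r x))).
  rewrite -(ge0_integralZl_EFin mu measurableT (fun y _ => H0 _) mc k0).
  apply: eq_integral => y _; rewrite /hartree_density -EFinM; congr EFin => /=.
  rewrite eucl_dist_scale3// /rescale !normrM (gtr0_norm s0) invfM.
  by move: (eucl_dist x y)^-1 => e; field; rewrite gt_eqF.
have mIs : measurable_fun setT (fun x : T3 => I (scale3 r x)).
  exact: (measurable_comp_scale3e r mI).
rewrite (ge0_integralZl_EFin mu measurableT _ _ k0); last 2 first.
- by move=> x _; rewrite mule_ge0// lee_fin.
- exact: emeasurable_funM.
rewrite (ge0_integralZl_EFin mu measurableT (fun x _ => I0 _) mIs r30).
rewrite ge0_integral_scale3// !muleA -!EFinM; congr (_%:E * _)%E.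
by field; rewrite gt_eqF.
Qed.

(* Where u(x) <> 0 and the potential is infinite, both sides are 0 by the
   convention [fine +oo = 0]. *)
Lemma fine_hartree_inner u x : measurable_fun setT (u : T3 -> R) ->
  fine (\int[mu]_y hartree_density u (x, y))%E = newton_potential u x * u x * u x.
Proof.
move=> mu_.
have mN : measurable_fun setT (fun y : T3 => (`|u y| ^+ 2 / eucl_dist x y)%:E).
  apply/measurable_EFinP; apply: measurable_funM.
    by apply: measurable_funX; exact: measurableT_comp.
  exact: (measurable_fun_pair2 x measurable_inv_eucl_dist).
rewrite /newton_potential /Rintegral -mulrA -expr2 mulrC -real_normK ?num_real//.
have [ux0|ux] := eqVneq (u x) 0.
  rewrite ux0 normr0 expr0n mul0r integral0_eq// => y _.
  by rewrite /hartree_density /= ux0 normr0 expr0n !mul0r.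
have ux0 : 0 < `|u x| ^+ 2 by rewrite exprn_gt0// normr_gt0.
have N0 (y : T3) : setT y -> (0 <= (`|u y| ^+ 2 / eucl_dist x y)%:E)%E.
  by move=> _; rewrite lee_fin divr_ge0 ?eucl_dist_ge0// exprn_ge0.
rewrite -fine_pmule// -(ge0_integralZl_EFin mu measurableT N0 mN (ltW ux0)).
by congr fine; apply: eq_integral => y _; rewrite -EFinM mulrA.
Qed.

(** Since the double integral is finite, the inner one is finite for almost every x, so taking
    [fine] inside [newton_potential] loses nothing. *)
Lemma hartree_weak u : measurable_fun setT (u : T3 -> R) ->
  (hartree u < +oo)%E ->
  \int[mu]_x (newton_potential u x * u x * u x) = fine (hartree u).
Proof.
move=> mu_ uoo; have mI := measurable_hartree_inner mu_.
have I0 (x : T3) : (0 <= \int[mu]_y hartree_density u (x, y))%E.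
  by apply: integral_ge0 => y _; exact: hartree_density_ge0.
have iI : mu.-integrable setT (fun x : T3 => \int[mu]_y hartree_density u (x, y))%E.
  apply/integrableP; split => //.
  by under eq_integral do rewrite gee0_abs//.
congr fine.
transitivity (\int[mu]_x (fine (\int[mu]_y hartree_density u (x, y))%E)%:E)%E.
  by apply: eq_integral => x _; rewrite fine_hartree_inner.
apply: ge0_ae_eq_integral => //.
- by apply/measurable_EFinP; exact: measurableT_comp.
- by move=> x _; rewrite lee_fin fine_ge0.
- by move=> x _; exact: I0.
refine (ae_mono _ (integrable_ae measurableT iI)) => x h _.
by rewrite fineK// h.
Qed.

End Hartree.

(** The formula for [f] is available on [x > 0] only, so [f], and then its derivative, is replaced
    by a polynomial near [t]. *)
Lemma sextic_derive (R : realType) (f : R -> R) (gamma a A B C t : R) :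
  (forall x, 0 < x ->
    f x = 2^-1 * (x ^+ 2 * A) - gamma / 4 * (x * B) - a / 6 * (x ^+ 6 * C)) ->
  0 < t ->
  derive1 f t = t * A - gamma / 4 * B - a * (t ^+ 5 * C) /\
  derive1n 2 f t = A - 5 * a * (t ^+ 4 * C).
Proof.
move=> fE t0.
pose p : {poly R} := (2^-1 * A) *: 'X^2 - (gamma / 4 * B) *: 'X - (a / 6 * C) *: 'X^6.
have D1 (x : R) : 0 < x -> is_derive x (1 : R) f (p^`().[x]).
  move=> x0; apply: (@near_eq_is_derive R R R (horner p) f x 1).
  near=> y; rewrite fE; last by near: y; exact: lt_nbhsr.
  by rewrite /p !(hornerD, hornerN, hornerZ, hornerXn, hornerX); field.
have E1 (x : R) : 0 < x -> derive1 f x = p^`().[x].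
  by move=> x0; rewrite derive1E; have [_] := D1 x x0.
have D2 : is_derive t (1 : R) (derive1 f) (p^`()^`().[t]).
  apply: (@near_eq_is_derive R R R (horner p^`()) _ t 1).
  by near=> y; rewrite E1//; near: y; exact: lt_nbhsr.
have E2 : derive1n 2 f t = p^`()^`().[t].
  by rewrite /= derive1E; have [_] := D2.
rewrite E1// E2 /p !(derivB, derivZ, derivXn, derivX, derivMn, derivC) /=.
rewrite !(hornerD, hornerN, hornerZ, hornerXn, hornerX, hornerMn, hornerC). split; field.
Unshelve. all: by end_near. Qed.

(** * A, B, C and the fibering map *)

Section Functionals.
Variable R : realType.
Notation T3 := (measurableTypeR R * measurableTypeR R * measurableTypeR R)%type.
Notation mu := (@lebesgue_measure3 R).
Implicit Types (u : R3 R -> R) (gamma a c lambda t : R).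

Local Notation A u := (fine (dirichlet u)).
Local Notation B u := (fine (hartree u)).
Local Notation C u := (fine (critical u)).

Lemma dirichlet_ge0 u : (0 <= dirichlet u)%E.
Proof.
by apply: integral_ge0 => x _; rewrite lee_fin sumr_ge0// => i _; rewrite exprn_ge0.
Qed.

Lemma hartree_ge0 u : (0 <= hartree u)%E.
Proof.
apply: integral_ge0 => x _; apply: integral_ge0 => y _.
exact: (hartree_density_ge0 u (x, y)).
Qed.

Lemma critical_ge0 u : (0 <= critical u)%E.
Proof. by apply: integral_ge0 => x _; rewrite lee_fin exprn_ge0. Qed.

Lemma dirichlet_fin_num u : H1 u -> dirichlet u \is a fin_num.
Proof.
move=> Hu; rewrite ge0_fin_numE ?dirichlet_ge0//.
have mg i : measurable_fun setT (fun x : T3 => (`|grad u i x| ^+ 2)%:E).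
  apply/measurable_EFinP; apply: measurable_funX.
  by apply: measurableT_comp => //; exact: measurable_grad.
rewrite /dirichlet; under eq_integral do rewrite -sumEFin.
have g0 i (x : T3) : setT x -> (0 <= (`|grad u i x| ^+ 2)%:E)%E.
  by move=> _; rewrite lee_fin exprn_ge0.
rewrite (ge0_integral_sum mu measurableT mg g0).
apply: lte_sum_pinfty => i _.
by have [/Lfun2P[_]] := gradP i Hu.
Qed.

Lemma mass_sphereP c u : mass_sphere c u <->
  H1 u /\ (\int[mu]_x (`|u x| ^+ 2)%:E = c%:E)%E.
Proof.
have e := Lnorm2_sqr mu u; split => -[Hu uc]; split => //.
  exact: eq_trans (esym e) uc.
exact: eq_trans e uc.
Qed.

Lemma mass_sphere_rescale s r c u : 0 < s -> 0 < r -> mass_sphere c u ->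
  mass_sphere (s ^+ 2 / r ^+ 3 * c) (rescale s r u).
Proof.
move=> s0 r0 /mass_sphereP[Hu uc]; apply/mass_sphereP; split; first exact: H1_rescale.
by rewrite integral_rescale_expr ?uc//; exact: H1_measurable.
Qed.

Lemma fine_dirichlet_rescale s r u : 0 < s -> 0 < r -> H1 u ->
  A (rescale s r u) = s ^+ 2 / r * A u.
Proof.
move=> s0 r0 Hu; rewrite dirichlet_rescale// fine_pmule//.
by rewrite divr_gt0 ?exprn_gt0.
Qed.

Lemma fine_hartree_rescale s r u : 0 < s -> 0 < r -> H1 u ->
  B (rescale s r u) = s ^+ 4 / r ^+ 5 * B u.
Proof.
move=> s0 r0 Hu; rewrite hartree_rescale ?fine_pmule//; last exact: H1_measurable.
by rewrite divr_gt0 ?exprn_gt0.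
Qed.

Lemma fine_critical_rescale s r u : 0 < s -> 0 < r -> H1 u ->
  C (rescale s r u) = s ^+ 6 / r ^+ 3 * C u.
Proof.
move=> s0 r0 Hu; rewrite /critical integral_rescale_expr ?fine_pmule//; last exact: H1_measurable.
by rewrite divr_gt0 ?exprn_gt0.
Qed.

Lemma powR32_sqr t : 0 < t -> (t `^ (3 / 2)) ^+ 2 = t ^+ 3.
Proof.
move=> t0; rewrite -powR_mulrn ?powR_ge0// -powRrM -powR_mulrn ?ltW//.
by congr powR; field.
Qed.

Lemma dilation_functionals u t : 0 < t -> H1 u ->
  [/\ A (dilation u t) = t ^+ 2 * A u, B (dilation u t) = t * B u
    & C (dilation u t) = t ^+ 6 * C u].
Proof.
move=> t0 Hu; have s0 : 0 < t `^ (3 / 2) by rewrite powR_gt0.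
have s2 := powR32_sqr t0.
split.
- apply: eq_trans (fine_dirichlet_rescale s0 t0 Hu) _.
  by rewrite s2; congr (_ * _); field; rewrite gt_eqF.
- apply: eq_trans (fine_hartree_rescale s0 t0 Hu) _.
  by rewrite (exprM _ 2 2) s2; congr (_ * _); field; rewrite gt_eqF.
- apply: eq_trans (fine_critical_rescale s0 t0 Hu) _.
  by rewrite (exprM _ 2 3) s2; congr (_ * _); field; rewrite gt_eqF.
Qed.

Lemma mass_sphere_dilation c u t : 0 < t -> mass_sphere c u ->
  mass_sphere c (dilation u t).
Proof.
move=> t0 uc; have s0 : 0 < t `^ (3 / 2) by rewrite powR_gt0.
have := mass_sphere_rescale s0 t0 uc.
by rewrite powR32_sqr// mulfV ?mul1r// expf_neq0// gt_eqF.
Qed.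

Lemma fiberingE gamma a u t : 0 < t -> H1 u -> fibering gamma a u t =
  2^-1 * (t ^+ 2 * A u) - gamma / 4 * (t * B u) - a / 6 * (t ^+ 6 * C u).
Proof.
move=> t0 Hu; have [eA eB eC] := dilation_functionals t0 Hu.
exact: (f_equal3 (fun x y z => 2^-1 * x - gamma / 4 * y - a / 6 * z) eA eB eC).
Qed.

Lemma fibering_derive gamma a u t : 0 < t -> H1 u ->
  derive1 (fibering gamma a u) t =
    t * A u - gamma / 4 * B u - a * (t ^+ 5 * C u) /\
  derive1n 2 (fibering gamma a u) t = A u - 5 * a * (t ^+ 4 * C u).
Proof.
by move=> t0 Hu; apply: sextic_derive => // x x0; exact: fiberingE.
Qed.

Lemma Lambda_minusP gamma a c u : mass_sphere c u ->
  Lambda_minus gamma a c u <->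
  A u - gamma / 4 * B u - a * C u = 0 /\ A u - 5 * a * C u < 0.
Proof.
move=> uc; have [Hu _] := uc.
have [e1 e2] := fibering_derive gamma a ltr01 Hu.
rewrite /Lambda_minus /= e1; move: e2 => /= ->.
rewrite !expr1n !mul1r; split => [[//]|[]]; by split.
Qed.

End Functionals.

(** * Levels *)

Section RealInequalities.
Variable R : realType.
Implicit Types (gamma a A B C K k e q : R).

Definition root4 (x : R) : R := Num.sqrt (Num.sqrt x).

Lemma root4_gt0 x : 0 < x -> 0 < root4 x.
Proof. by move=> x0; rewrite !sqrtr_gt0. Qed.

Lemma root4X x : 0 <= x -> root4 x ^+ 4 = x.
Proof. by move=> x0; rewrite (exprM _ 2 2) !sqr_sqrtr// sqrtr_ge0. Qed.

(* In terms of b = (a K)^(1/4) sqrt A, normalised so that the limit level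
   becomes 1. *)
Lemma normalized_level_ge (b eta : R) : 0 < b -> 1 < 5 * b ^+ 4 ->
  b - b ^+ 5 <= eta -> 0 <= eta -> eta <= 1 / 5 ->
  1 - 9 / 2 * eta <= b ^+ 2 - 5 / 2 * eta * b.
Proof.
move=> b0 b5 be eta0 eta5.
have bh : 1 / 2 < b.
  rewrite ltNge; apply/negP => bh.
  have h2 : b ^+ 2 <= 1 / 4 by rewrite expr2; nra.
  have h4 : b ^+ 4 <= 1 / 16 by rewrite (exprM _ 2 2) [_ ^+ 2]expr2; have := sqr_ge0 b; nra.
  lra.
(* For [b >= 1], [eta <= 1/5] keeps [b - 5/2 eta] positive, so [b (b - 5/2 eta) >= 1 - 5/2 eta]. *)
have [b1|b1] := leP 1 b; first by rewrite expr2; nra.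
(* As [b > 1/2], [b (1 - b^4) <= eta] yields [1 - b^4 <= 2 eta], and [b < 1] passes this to [b^2].
   The final constant is [9/2 = 2 + 5/2]. *)
have h4 : 1 - 2 * eta <= b ^+ 4.
  rewrite leNgt; apply/negP => h.
  have : b * (1 - b ^+ 4) <= eta by rewrite mulrBr mulr1 -exprS.
  nra.
have h2 : 1 - 2 * eta <= b ^+ 2.
  rewrite leNgt; apply/negP => h.
  have : b ^+ 4 = b ^+ 2 * b ^+ 2 by rewrite -exprD.
  have := sqr_ge0 b; nra.
nra.
Qed.

(** Put [m = (a K)^(1/4)], [al = sqrt A], [b = m al], [eta = m gamma k e / 4]. Then [g1], multiplied
    by [m / al], yields [b - b^5 <= eta], [g2] yields [1 < 5 b^4], and the energy is at least
    [(b^2 - 5/2 eta b) / (3 m^2)]. *)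
Lemma level_ge gamma a K k e A B C : 0 < gamma -> 0 < a -> 0 < K -> 0 < k ->
  0 < e -> 0 <= A -> 0 <= B -> B <= k * Num.sqrt A * e ->
  C <= K * A ^+ 3 ->
  A - gamma / 4 * B - a * C = 0 -> A - 5 * a * C < 0 ->
  root4 (a * K) * gamma * k / 4 * e <= 1 / 5 ->
  1 / (3 * Num.sqrt (a * K)) * (1 - 9 / 2 * (root4 (a * K) * gamma * k / 4 * e)) <=
  2^-1 * A - gamma / 4 * B - a / 6 * C.
Proof.
move=> g0 a0 K0 k0 e0 A0 B0 BA CA g1 g2 small.
set m := root4 (a * K) in small *.
have aK0 : 0 < a * K by rewrite mulr_gt0.
have m0 : 0 < m by exact: root4_gt0.
have m2 : Num.sqrt (a * K) = m ^+ 2 by rewrite sqr_sqrtr// sqrtr_ge0.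
have m4 : m ^+ 4 = a * K by apply: root4X; exact: ltW.
set al := Num.sqrt A in BA.
have al2 : al ^+ 2 = A by exact: sqr_sqrtr.
have al0 : 0 <= al by exact: sqrtr_ge0.
rewrite m2; rewrite -al2 in CA g1 g2 *.
clearbody m al; clear al2 A0 m2 A aK0.
have aC : a * C <= m ^+ 4 * al ^+ 6.
  by rewrite m4 -mulrA ler_pM2l// (exprM _ 2 3).
have gB : gamma * B <= gamma * k * al * e.
  by rewrite -!mulrA ler_pM2l// mulrA.
have al_gt0 : 0 < al.
  rewrite lt_neqAle al0 andbT eq_sym; apply/eqP => z; move: g2 aC.
  by rewrite z !expr0n !mulr0/=; lra.
pose b := m * al.
have b0 : 0 < b by rewrite mulr_gt0.
pose eta := m * gamma * k / 4 * e.
have eta0 : 0 <= eta by rewrite /eta !mulr_ge0// ltW.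
have al2 : 0 < al ^+ 2 by rewrite exprn_gt0.
have b5 : 1 < 5 * b ^+ 4.
  rewrite -(ltr_pM2l al2) mulr1 /b exprMn.
  have -> : al ^+ 2 * (5 * (m ^+ 4 * al ^+ 4)) = 5 * (m ^+ 4 * al ^+ 6) by ring.
  lra.
have beta : b - b ^+ 5 <= eta.
  rewrite -(ler_pM2l al_gt0).
  have -> : al * (b - b ^+ 5) = m * (al ^+ 2 - m ^+ 4 * al ^+ 6) by rewrite /b; ring.
  have -> : al * eta = m * (gamma * k * al * e / 4) by rewrite /eta; ring.
  rewrite ler_pM2l//; lra.
have := normalized_level_ge b0 b5 beta eta0 small.
have m2_gt0 : 0 < m ^+ 2 by rewrite exprn_gt0.
have -> : 1 / (3 * m ^+ 2) * (1 - 9 / 2 * (m * gamma * k / 4 * e)) =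
  (1 - 9 / 2 * eta) / (3 * m ^+ 2) by rewrite /eta; field; rewrite gt_eqF.
rewrite ler_pdivrMr ?mulr_gt0// => h; apply: (le_trans h).
have -> : b ^+ 2 - 5 / 2 * eta * b = (al ^+ 2 / 3 - 5 / 24 * (gamma * k * al * e)) * (3 * m ^+ 2).
  by rewrite /b /eta; field.
rewrite ler_pM2r ?mulr_gt0//; lra.
Qed.

(** [t0] is the inflection point of the fibering map. The derivative is positive there and
    nonpositive at [2 t0]; it has a zero in between, where the second derivative is already
    negative. *)
Lemma fibering_root gamma a K k e A B C q : 0 < gamma -> 0 < a -> 0 < K ->
  0 < A -> 0 <= B -> B <= k * Num.sqrt A * e -> 0 < C ->
  C <= K * A ^+ 3 -> 0 < q -> q ^+ 4 = 1 / (5 * a * K) ->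
  gamma / 4 * (k * e) < 4 / 5 * q ->
  exists t : R, [/\ 0 < t, t * A - gamma / 4 * B - a * (t ^+ 5 * C) = 0
    & A - 5 * a * (t ^+ 4 * C) < 0].
Proof.
move=> g0 a0 K0 A0 B0 BA C0 CA q0 q4 ke.
pose t0 := root4 (A / (5 * a * C)).
have aC0 : 0 < 5 * a * C by rewrite !mulr_gt0.
have t00 : 0 < t0 by apply: root4_gt0; rewrite divr_gt0.
have t04 : t0 ^+ 4 * (5 * a * C) = A by rewrite root4X ?divr_ge0 ?ltW// mulfVK// gt_eqF.
have al0 : 0 < Num.sqrt A by rewrite sqrtr_gt0.
have al2 : Num.sqrt A ^+ 2 = A by rewrite sqr_sqrtr// ltW.
(* From [C <= K A^3], [(t0 sqrt A)^4 = A^3 / (5 a C) >= 1 / (5 a K) = q^4]. *)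
have qt : q <= t0 * Num.sqrt A.
  have ta0 : 0 < t0 * Num.sqrt A by rewrite mulr_gt0.
  rewrite -(@ler_pXn2r _ 4)// ?nnegrE; [|exact: ltW|exact: ltW].
  rewrite q4 exprMn (exprM (Num.sqrt A) 2 2) al2 ler_pdivrMr ?mulr_gt0//.
  rewrite -(ler_pM2r A0) mul1r -{1}t04.
  have -> : t0 ^+ 4 * A ^+ 2 * (5 * a * K) * A = t0 ^+ 4 * (5 * a * (K * A ^+ 3)) by ring.
  by rewrite ler_pM2l ?exprn_gt0// ler_pM2l// mulr_gt0.
pose f t := t * A - gamma / 4 * B - a * (t ^+ 5 * C).
have ft0 : 0 < f t0.
  have -> : f t0 = 4 / 5 * (t0 * A) - gamma / 4 * B.
    by rewrite /f -{1 2}t04; field.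
  have h1 : gamma / 4 * B <= gamma / 4 * (k * e) * Num.sqrt A.
    have -> : gamma / 4 * (k * e) * Num.sqrt A = gamma / 4 * (k * Num.sqrt A * e) by ring.
    by rewrite ler_pM2l// divr_gt0.
  have h2 : gamma / 4 * (k * e) * Num.sqrt A < 4 / 5 * q * Num.sqrt A.
    by rewrite ltr_pM2r.
  have h3 : 4 / 5 * q * Num.sqrt A <= 4 / 5 * (t0 * A).
    by rewrite -mulrA ler_pM2l// -{2}al2 expr2 mulrA ler_pM2r.
  lra.
(* As [a t0^5 C = t0 A / 5], the sextic term at [2 t0] is [32/5 t0 A], which exceeds [2 t0 A]. *)
have ft1 : f (2 * t0) <= 0.
  have -> : f (2 * t0) = - (22 / 5 * (t0 * A)) - gamma / 4 * B.
    by rewrite /f -{1 2}t04; field.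
  have h1 : 0 <= gamma / 4 * B by rewrite mulr_ge0// divr_ge0// ltW.
  have h2 : 0 < t0 * A by rewrite mulr_gt0.
  lra.
have cf : continuous f.
  move=> x; apply: cvgB; first apply: cvgB; [|exact: cvg_cst|].
    by apply: cvgM; [exact: cvg_id|exact: cvg_cst].
  apply: cvgM; first exact: cvg_cst.
  by apply: cvgM; [exact: exprn_continuous|exact: cvg_cst].
have t01 : t0 <= 2 * t0 by lra.
have [|t tI ft] := @IVT R f t0 (2 * t0) 0 t01 (continuous_subspaceT cf).
  by rewrite ge_min le_max (ltW ft0) ft1 orbT.
exists t; move: tI; rewrite in_itv/= => /andP[t0t _].
have t0t' : t0 < t.
  by rewrite lt_neqAle t0t andbT; apply/eqP => E; move: ft0; rewrite E ft ltxx.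
split => //; first exact: lt_trans t0t'.
have -> : 5 * a * (t ^+ 4 * C) = t ^+ 4 * (5 * a * C) by ring.
rewrite -t04 -mulrBl pmulr_llt0// subr_lt0 ltrXn2r//; exact: ltW.
Qed.

(** With [y = sqrt(a K) A] the claim reduces to [y/2 - y^3/6 <= 1/3], that is
    [(y - 1)^2 (y + 2) >= 0]. *)
Lemma level_le gamma a K A B C : 0 < gamma -> 0 < a -> 0 < K -> 0 <= A ->
  0 <= B -> K * A ^+ 3 <= C ->
  2^-1 * A - gamma / 4 * B - a / 6 * C <= 1 / (3 * Num.sqrt (a * K)).
Proof.
move=> g0 a0 K0 A0 B0 CA.
have aK0 : 0 < a * K by rewrite mulr_gt0.
set m := Num.sqrt (a * K).
have m0 : 0 < m by rewrite sqrtr_gt0.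
have m2 : m ^+ 2 = a * K by rewrite sqr_sqrtr// ltW.
rewrite ler_pdivlMr ?mulr_gt0//.
have h1 : 0 <= gamma / 4 * B by rewrite mulr_ge0// divr_ge0// ltW.
have h2 : a * (K * A ^+ 3) <= a * C by rewrite ler_pM2l.
rewrite mulrA -m2 in h2.
have h3 : 0 <= (m * A - 1) ^+ 2 * (m * A + 2).
  by rewrite mulr_ge0 ?sqr_ge0// addr_ge0// mulr_ge0// ltW.
have h4 : m * (m ^+ 2 * A ^+ 3) <= m * (a * C) by rewrite ler_pM2l.
have h5 : 0 <= m * (gamma / 4 * B) by rewrite mulr_ge0// ltW.
have : (m * A - 1) ^+ 2 * (m * A + 2) = m * (m ^+ 2 * A ^+ 3) - 3 * (m * A) + 2 by ring.
have -> : (2^-1 * A - gamma / 4 * B - a / 6 * C) * (3 * m) =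
  3 / 2 * (m * A) - 3 * (m * (gamma / 4 * B)) - m * (a * C) / 2 by field.
lra.
Qed.

End RealInequalities.

(** * Bounds on gamma^-(c) and on the Lagrange parameter *)

Section Levels.
Variable R : realType.
Notation T3 := (measurableTypeR R * measurableTypeR R * measurableTypeR R)%type.
Notation mu := (@lebesgue_measure3 R).
Variables (gamma a KH KGN : R).
Hypotheses (gamma_gt0 : 0 < gamma) (a_gt0 : 0 < a)
  (KH_gt0 : 0 < KH) (KHP : hartree_constant KH)
  (KGN_gt0 : 0 < KGN) (KGNP : optimal_sobolev_constant KGN).

Local Notation A u := (fine (dirichlet u)).
Local Notation B u := (fine (hartree u)).
Local Notation C u := (fine (critical u)).
Local Notation level := (1 / (3 * Num.sqrt (a * KGN))).

Lemma functional_bounds c (u : R3 R -> R) : 0 < c -> mass_sphere c u ->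
  [/\ 0 <= A u, 0 <= B u, 0 <= C u, B u <= KH * Num.sqrt (A u) * c `^ (3 / 2)
    & C u <= KGN * A u ^+ 3].
Proof.
move=> c0 uc; have [Hu _] := uc; split.
- exact/fine_ge0/dirichlet_ge0.
- exact/fine_ge0/hartree_ge0.
- exact/fine_ge0/critical_ge0.
- have h := KHP c0 uc.
  have f : hartree u \is a fin_num.
    by rewrite ge0_fin_numE ?hartree_ge0//; apply: le_lt_trans h _; rewrite ltry.
  by rewrite -lee_fin (fineK f).
- have := KGNP.1 u Hu; rewrite -(fineK (dirichlet_fin_num Hu)) -EFin_expe -EFinM => h.
  have f : critical u \is a fin_num.
    by rewrite ge0_fin_numE ?critical_ge0//; apply: le_lt_trans h _; rewrite ltry.
  by rewrite -lee_fin (fineK f).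
Qed.

Lemma hartree_lty c (u : R3 R -> R) : 0 < c -> mass_sphere c u ->
  (hartree u < +oo)%E.
Proof. by move=> c0 uc; apply: le_lt_trans (KHP c0 uc) _; rewrite ltry. Qed.

Lemma c_one_powR32 : c_one gamma a KH KGN `^ (3 / 2) =
  16 / (5 * gamma * KH) * (1 / (5 * a * KGN)) `^ (1 / 4).
Proof.
have h1 : 0 <= 16 / (5 * gamma * KH) by rewrite divr_ge0// !mulr_ge0// ltW.
rewrite /c_one powRM ?powR_ge0// -!powRrM.
have -> : 2 / 3 * (3 / 2) = 1 :> R by field.
have -> : 1 / 6 * (3 / 2) = 1 / 4 :> R by field.
by rewrite powRr1.
Qed.

Lemma powR32_lt c c' : 0 < c -> c < c' -> c `^ (3 / 2) < c' `^ (3 / 2) :> R.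
Proof.
by move=> c0 cc1; apply: gt0_ltr_powR => //; rewrite nnegrE ltW// (lt_trans c0).
Qed.

(** This is where the value of c_1 comes from: its power 3/2 is [16 q / (5 gamma KH)], so at
    [c = c_1] the last inequality becomes an equality. *)
Lemma small_mass c : 0 < c -> c < c_one gamma a KH KGN ->
  exists q : R, [/\ 0 < q, q ^+ 4 = 1 / (5 * a * KGN)
    & gamma / 4 * (KH * c `^ (3 / 2)) < 4 / 5 * q].
Proof.
move=> c0 cc1; exists ((1 / (5 * a * KGN)) `^ (1 / 4)).
have y0 : 0 < 1 / (5 * a * KGN) by rewrite divr_gt0// !mulr_gt0.
split; first exact: powR_gt0.
  rewrite -powR_mulrn ?powR_ge0// -powRrM.
  by have -> : 1 / 4 * 4%:R = 1 :> R by [field]; rewrite powRr1 ?ltW.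
have := powR32_lt c0 cc1; rewrite c_one_powR32.
move: (_ `^ (1 / 4)) => q h.
have gK : 0 < gamma / 4 * KH by rewrite mulr_gt0// divr_gt0.
rewrite mulrA (lt_le_trans (y := gamma / 4 * KH * (16 / (5 * gamma * KH) * q)))//.
  by rewrite ltr_pM2l.
by rewrite le_eqVlt; apply/orP; left; apply/eqP; field; rewrite !gt_eqF.
Qed.

(** By optimality [K'] fails for some [w]. Its mass is positive, as is necessary for rescaling it to
    mass c: otherwise [w = 0] almost everywhere and C(w) = 0, against [K' A(w)^3 < C(w)]. *)
Lemma sobolev_near_optimizer (K' : R) : 0 < K' -> K' < KGN ->
  exists w : R3 R -> R, exists2 m : R, 0 < m &
    mass_sphere m w /\ K' * A w ^+ 3 < C w.
Proof.
move=> K'0 K'K.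
have : ~ sobolev_constant K' by move=> /(KGNP.2 _); rewrite leNgt K'K.
move=> /existsNP[w /not_implyP[Hw /negP]]; rewrite -ltNge => h.
have Dw := dirichlet_fin_num Hw.
have Cw : critical w \is a fin_num.
  rewrite ge0_fin_numE ?critical_ge0//; apply: le_lt_trans (KGNP.1 w Hw) _.
  by rewrite -(fineK Dw) -EFin_expe -EFinM ltry.
have hC : K' * A w ^+ 3 < C w.
  by rewrite -lte_fin EFinM EFin_expe !fineK.
have /Lfun2P[mw w2] := Hw.1.
have m2 : measurable_fun setT (fun x : T3 => (`|w x| ^+ 2)%:E).
  by apply/measurable_EFinP; apply: measurable_funX; exact: measurableT_comp.
have m0 : (0 <= \int[mu]_x (`|w x| ^+ 2)%:E)%E.
  by apply: integral_ge0 => x _; rewrite lee_fin exprn_ge0.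
have mfin : (\int[mu]_x (`|w x| ^+ 2)%:E)%E \is a fin_num by rewrite ge0_fin_numE.
exists w, (fine (\int[mu]_x (`|w x| ^+ 2)%:E)%E); last first.
  by split => //; apply/mass_sphereP; split => //; rewrite fineK.
rewrite fine_gt0// -ge0_fin_numE// mfin andbT lt_neqAle m0 andbT eq_sym.
apply/negP => /eqP z.
have : (\int[mu]_x `|(`|w x| ^+ 2)%:E| = 0)%E.
  by rewrite -[RHS]z; apply: eq_integral => x _; rewrite gee0_abs// lee_fin exprn_ge0.
move=> /(ae_eq_integral_abs mu measurableT m2) w0.
have C0 : critical w = 0%E.
  rewrite /critical -[RHS](integral0 mu setT).
  apply: ge0_ae_eq_integral => //.
  - by apply/measurable_EFinP; apply: measurable_funX; exact: measurableT_comp.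
  refine (ae_mono _ w0) => x /(_ I) [] /eqP; rewrite expf_eq0/= => /eqP -> _.
  by rewrite expr0n.
move: hC; rewrite C0 /= ltNge => /negP; apply.
apply: mulr_ge0; first exact: ltW.
by apply: exprn_ge0; exact/fine_ge0/dirichlet_ge0.
Qed.

(** The factor [sqrt (c / m)] brings [w] to mass c, and a dilation, preserving the mass, brings it
    onto Lambda^-. Both multiply A^3 and C by the same number, so [K' A^3 < C] persists up to the
    energy estimate. *)
Lemma Lambda_minus_level (K' c : R) : 0 < K' -> K' < KGN -> 0 < c ->
  c < c_one gamma a KH KGN ->
  exists2 u : R3 R -> R, Lambda_minus gamma a c u &
    energy gamma a u <= 1 / (3 * Num.sqrt (a * K')).
Proof.
move=> K'0 K'K c0 cc1.
have [w [m m0 [wm K'w]]] := sobolev_near_optimizer K'0 K'K.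
have s0 : 0 < Num.sqrt (c / m) by rewrite sqrtr_gt0 divr_gt0.
pose v := rescale (Num.sqrt (c / m)) 1 w.
have [Hw _] := wm.
have vc : mass_sphere c v.
  have := mass_sphere_rescale s0 ltr01 wm.
  by rewrite sqr_sqrtr ?divr_ge0 ?ltW// expr1n divr1 mulfVK// gt_eqF.
have [Hv _] := vc.
have K'v : K' * A v ^+ 3 < C v.
  have eA := fine_dirichlet_rescale s0 ltr01 Hw.
  have eC := fine_critical_rescale s0 ltr01 Hw.
  rewrite -/v in eA eC; rewrite eA eC.
  move: (A w) (C w) K'w => Aw Cw K'w.
  have -> : K' * (Num.sqrt (c / m) ^+ 2 / 1 * Aw) ^+ 3 =
    Num.sqrt (c / m) ^+ 6 * (K' * Aw ^+ 3) by field.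
  by rewrite expr1n divr1 ltr_pM2l// exprn_gt0.
have [q [q0 q4 qe]] := small_mass c0 cc1.
have [Av0 Bv0 Cv0 BvA CvA] := functional_bounds c0 vc.
have Cv : 0 < C v by apply: le_lt_trans K'v; rewrite mulr_ge0 ?exprn_ge0// ltW.
have Av : 0 < A v.
  rewrite lt_neqAle Av0 andbT eq_sym; apply/negP => /eqP z.
  by move: (lt_le_trans Cv CvA); rewrite z expr0n mulr0 ltxx.
have [t [t0 gt1 gt2]] := fibering_root gamma_gt0 a_gt0 KGN_gt0 Av Bv0 BvA Cv CvA q0 q4 qe.
have [eA eB eC] := dilation_functionals t0 Hv.
have uc := mass_sphere_dilation t0 vc.
have t20 : 0 < t ^+ 2 by rewrite exprn_gt0.
exists (dilation v t).
  apply/(Lambda_minusP gamma a uc); rewrite eA eB eC.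
  move: (A v) (B v) (C v) gt1 gt2 => Av' Bv' Cv' gt1 gt2; split.
    transitivity (t * (t * Av' - gamma / 4 * Bv' - a * (t ^+ 5 * Cv'))); first by ring.
    by rewrite gt1 mulr0.
  have -> : t ^+ 2 * Av' - 5 * a * (t ^+ 6 * Cv') = t ^+ 2 * (Av' - 5 * a * (t ^+ 4 * Cv')) by ring.
  by rewrite pmulr_rlt0.
have A0 : 0 <= A (dilation v t) by exact/fine_ge0/dirichlet_ge0.
have B0 : 0 <= B (dilation v t) by exact/fine_ge0/hartree_ge0.
have CA : K' * A (dilation v t) ^+ 3 <= C (dilation v t).
  rewrite eA eC; move: (A v) (C v) K'v => Av' Cv' K'v.
  have -> : K' * (t ^+ 2 * Av') ^+ 3 = t ^+ 6 * (K' * Av' ^+ 3) by ring.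
  by rewrite ler_pM2l ?exprn_gt0// ltW.
exact: (level_le gamma_gt0 a_gt0 K'0 A0 B0 CA).
Qed.

Lemma gamma_minus_le c : 0 < c -> c < c_one gamma a KH KGN ->
  (gamma_minus gamma a c <= level%:E)%E.
Proof.
move=> c0 cc1; apply/lee_addgt0Pr => e e0.
have aK0 : 0 < a * KGN by rewrite mulr_gt0.
have s0 : 0 < Num.sqrt (a * KGN) by rewrite sqrtr_gt0.
have L0 : 0 < level by rewrite divr_gt0// mulr_gt0.
have Le0 : 0 < 3 * (level + e) by rewrite mulr_gt0// addr_gt0.
(* Solves [1 / (3 sqrt (a K')) = level + e]; since [e > 0], this [K'] lies below [KGN]. *)
pose K' := (3 * (level + e)) ^- 2 / a.
have K'0 : 0 < K' by rewrite divr_gt0// invr_gt0 exprn_gt0.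
have aK' : Num.sqrt (a * K') = (3 * (level + e))^-1.
  rewrite /K' mulrC divfK ?gt_eqF// -exprVn sqrtr_sqr ger0_norm// invr_ge0 ltW//.
have K'K : K' < KGN.
  rewrite -(ltr_pM2l a_gt0) -ltr_sqrt// aK' invf_plt ?posrE//.
  by rewrite mulrDr div1r invfM mulVKf// ltrDl mulr_gt0.
have [u uL ue] := Lambda_minus_level K'0 K'K c0 cc1.
apply: (@le_trans _ _ (energy gamma a u)%:E).
  by apply: ereal_inf_lbound; exists u.
rewrite -EFinD lee_fin; apply: (le_trans ue).
by rewrite aK' invfM invrK mul1r mulKf.
Qed.

Lemma gamma_minus_ge c : 0 < c ->
  root4 (a * KGN) * gamma * KH / 4 * c `^ (3 / 2) <= 1 / 5 ->
  ((level * (1 - 9 / 2 * (root4 (a * KGN) * gamma * KH / 4 * c `^ (3 / 2))))%:E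
   <= gamma_minus gamma a c)%E.
Proof.
move=> c0 small; apply: le_ereal_inf_tmp => _ [u uL <-]; rewrite lee_fin.
have uc : mass_sphere c u by case: uL.
have /(Lambda_minusP gamma a uc)[g1 g2] := uL.
have [A0 B0 _ BA CA] := functional_bounds c0 uc.
by apply: level_ge => //; exact: powR_gt0.
Qed.

Lemma gamma_minus_cvg :
  gamma_minus gamma a c @[c --> (0 : R)^'+] --> level%:E.
Proof.
pose k := root4 (a * KGN) * gamma * KH / 4.
have k0 : 0 < k.
  by rewrite divr_gt0// !mulr_gt0// root4_gt0// mulr_gt0.
have c10 : 0 < c_one gamma a KH KGN.
  by rewrite mulr_gt0// powR_gt0// divr_gt0// !mulr_gt0.
(* Below this value of [c^(3/2)] the smallness condition of the lower bound holds. *)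
have e0 : 0 < k^-1 * (1 / 5) by rewrite mulr_gt0// ?invr_gt0// divr_gt0.
have pc : c `^ (3 / 2) @[c --> (0 : R)^'+] --> (0 : R) by exact: powR_cvg0.
apply: (@squeeze_cvge _ _ _ _ (fun c => (level * (1 - 9 / 2 * (k * c `^ (3 / 2))))%:E)
  _ (fun=> level%:E)); last exact: cvg_cst.
- near=> c.
  have c0 : 0 < c by near: c; exact: nbhs_right_gt.
  apply/andP; split.
    apply: gamma_minus_ge => //; rewrite -/k -ler_pdivlMl//.
    by apply: ltW; near: c; exact: (cvgr_lt 0 pc).
  by apply: gamma_minus_le => //; near: c; exact: nbhs_right_lt.
- apply: cvg_EFin; first exact: nearW.
  have : level * (1 - 9 / 2 * (k * c `^ (3 / 2))) @[c --> (0 : R)^'+] -->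
      level * (1 - 9 / 2 * (k * 0)).
    apply: cvgM; first exact: cvg_cst.
    apply: cvgB; first exact: cvg_cst.
    apply: cvgM; first exact: cvg_cst.
    by apply: cvgM; first exact: cvg_cst.
  by rewrite !mulr0 subr0 mulr1.
Unshelve. all: by end_near. Qed.

(** Tested with u, the equation reads [A + lambda c - gamma B - a C = 0]; subtracting
    [A - gamma/4 B - a C = 0] removes A and C, leaving the coefficient [1 - 1/4]. *)
Lemma multiplier_eq lambda c (u : R3 R -> R) : 0 < c ->
  Lambda_minus gamma a c u -> weak_solution gamma a lambda u ->
  lambda * c = 3 / 4 * gamma * B u.
Proof.
move=> c0 uL [Hu weak].
have uc : mass_sphere c u by case: uL.
have /(Lambda_minusP gamma a uc)[g1 _] := uL.
have eA : \int[mu]_x (\sum_(i < 3) grad u i x * grad u i x) = A u.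
  congr fine; apply: eq_integral => x _; congr EFin; apply: eq_bigr => i _.
  by rewrite real_normK ?num_real// expr2.
have em : \int[mu]_x (u x * u x) = c.
  have /mass_sphereP[_ e] := uc.
  rewrite -[RHS]/(fine c%:E) -e; congr fine; apply: eq_integral => x _; congr EFin.
  by rewrite real_normK ?num_real// expr2.
have eB := hartree_weak (H1_measurable Hu) (hartree_lty c0 uc).
have eC : \int[mu]_x (`|u x| ^+ 4 * u x * u x) = C u.
  congr fine; apply: eq_integral => x _; congr EFin.
  by rewrite -mulrA -expr2 -[u x ^+ 2]real_normK ?num_real// -exprD.
have := weak u Hu; rewrite eA em eB eC.
move: (A u) (B u) (C u) g1 => Au Bu Cu; lra.
Qed.

(** On Lambda^- the energy bound is [al^2/3 - k al <= L] with [al = sqrt A], and [k] is taken at c_1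
    to be uniform in c. If [al > 3 k + 3 L + 1], then [al > 1] and [al/3 - k > L + 1/3], whose
    product exceeds [L]. *)
Lemma dirichlet_bound c (u : R3 R -> R) : 0 < c -> c < c_one gamma a KH KGN ->
  Lambda_minus gamma a c u -> energy gamma a u <= level ->
  Num.sqrt (A u) <=
    3 * (5 / 24 * gamma * KH * c_one gamma a KH KGN `^ (3 / 2)) + 3 * level + 1.
Proof.
move=> c0 cc1 uL; rewrite /energy.
have uc : mass_sphere c u by case: uL.
have /(Lambda_minusP gamma a uc)[g1 _] := uL.
have [A0 _ _ BA _] := functional_bounds c0 uc.
have L0 : 0 < level by rewrite divr_gt0// mulr_gt0// sqrtr_gt0 mulr_gt0.
have e1 := ltW (powR32_lt c0 cc1).
have e0 : 0 <= c `^ (3 / 2) := powR_ge0 _ _.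
move: (A u) (B u) (C u) g1 A0 BA => Au Bu Cu g1 A0 BA.
move: level L0 => L L0.
move: (c `^ (3 / 2)) (c_one gamma a KH KGN `^ (3 / 2)) e0 e1 BA => e e' e0 ee' BA.
have al2 : Num.sqrt Au ^+ 2 = Au by exact: sqr_sqrtr.
have al0 : 0 <= Num.sqrt Au by exact: sqrtr_ge0.
move: (Num.sqrt Au) al2 al0 BA => al al2 al0 BA EL.
rewrite leNgt; apply/negP => h.
have k0 : 0 <= 5 / 24 * gamma * KH * e'.
  apply: mulr_ge0; last exact: (le_trans e0 ee').
  by apply: mulr_ge0 (ltW KH_gt0); apply: mulr_ge0 (ltW gamma_gt0); lra.
have BA' : Bu <= KH * al * e'.
  by apply: (le_trans BA); rewrite ler_wpM2l// mulr_ge0// ltW.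
have gB : 5 / 24 * (gamma * Bu) <= 5 / 24 * gamma * KH * e' * al.
  have -> : 5 / 24 * gamma * KH * e' * al = 5 / 24 * (gamma * (KH * al * e')) by ring.
  by rewrite ler_pM2l ?divr_gt0// ler_pM2l.
move: (5 / 24 * gamma * KH * e') h gB k0 => k h gB k0.
have EA : al * (al / 3 - k) <= L.
  have -> : al * (al / 3 - k) = al ^+ 2 / 3 - k * al by ring.
  lra.
have : al * (L + 1 / 3) < al * (al / 3 - k) by rewrite ltr_pM2l; lra.
have : 1 * (L + 1 / 3) <= al * (L + 1 / 3) by rewrite ler_wpM2r; lra.
lra.
Qed.

End Levels.

Theorem lemma3p26 (R : realType) (gamma a KH KGN : R)
    (gamma_gt0 : 0 < gamma) (a_gt0 : 0 < a)
    (KH_gt0 : 0 < KH) (KHP : hartree_constant KH)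
    (KGN_gt0 : 0 < KGN) (KGNP : optimal_sobolev_constant KGN) :
  gamma_minus gamma a c @[c --> (0 : R)^'+] -->
    (1 / (3 * Num.sqrt (a * KGN)))%:E /\
  exists K1 : R, 0 < K1 /\
    forall (c lambda : R) (u : R3 R -> R),
      0 < c -> c < c_one gamma a KH KGN ->
      Lambda_minus gamma a c u ->
      (energy gamma a u)%:E = gamma_minus gamma a c ->
      weak_solution gamma a lambda u ->
      lambda <= K1 * c `^ (1 / 2).
Proof.
split; first exact: (gamma_minus_cvg gamma_gt0 a_gt0 KH_gt0 KHP KGN_gt0 KGNP).
pose M := 3 * (5 / 24 * gamma * KH * c_one gamma a KH KGN `^ (3 / 2)) +
  3 * (1 / (3 * Num.sqrt (a * KGN))) + 1.
have M0 : 0 < M.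
  have h1 : 0 <= 5 / 24 * gamma * KH * c_one gamma a KH KGN `^ (3 / 2).
    by apply: mulr_ge0; rewrite ?powR_ge0// !mulr_ge0 ?divr_ge0// ltW.
  have h2 : 0 <= 1 / (3 * Num.sqrt (a * KGN)).
    by rewrite divr_ge0// mulr_ge0// sqrtr_ge0.
  by rewrite /M; lra.
(* From [lambda c = 3/4 gamma B] and [B <= KH M c^(3/2)]; dividing by c leaves [c^(1/2)]. *)
exists (3 / 4 * gamma * KH * M); split; first by rewrite !mulr_gt0.
move=> c lambda u c0 cc1 uL uE weak.
have uc : mass_sphere c u by case: uL.
have EL : energy gamma a u <= 1 / (3 * Num.sqrt (a * KGN)).
  by rewrite -lee_fin uE; exact: (gamma_minus_le gamma_gt0 a_gt0 KH_gt0 KHP KGN_gt0 KGNP c0 cc1).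
have AM : Num.sqrt (fine (dirichlet u)) <= M.
  exact: (dirichlet_bound gamma_gt0 a_gt0 KH_gt0 KHP KGN_gt0 KGNP c0 cc1 uL EL).
have [_ _ _ BA _] := functional_bounds KHP KGNP c0 uc.
have lc := multiplier_eq KHP c0 uL weak.
have c32 : c `^ (3 / 2) = c * c `^ (1 / 2).
  have -> : 3 / 2 = 1 + 1 / 2 :> R by field.
  by rewrite powRD ?powRr1 ?ltW// (gt_eqF c0) implybT.
rewrite -(ler_pM2r c0) lc.
apply: (@le_trans _ _ (3 / 4 * gamma * (KH * M * c `^ (3 / 2)))).
  rewrite ler_pM2l ?mulr_gt0 ?divr_gt0//; apply: (le_trans BA).
  by rewrite ler_wpM2r ?powR_ge0// ler_pM2l.
rewrite c32 le_eqVlt; apply/orP; left; apply/eqP; ring.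
Qed.
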